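(* Assume that the Titchmarsh-Weyl function $m_\infty$ is meromorphic in $\mathbb{C}$, let $h\in\mathbb{C}$ with $\operatorname{Im}h>0$, and put $$S_h(\lambda)=\frac{m_\infty(\lambda)-h}{m_\infty(\lambda)-\overline{h}} .$$ Then the function $\overline{S_h}$ (that is, $\lambda\mapsto\overline{S_h(\lambda)}$, $\lambda\in\mathbb{R}$) is the scattering matrix of the unitary group $\{U_h(s)\}_{s\in\mathbb{R}}$, $U_h(s)=\exp(iM_hs)$, i.e. of the selfadjoint operator $M_h$, with respect to the subspaces $\mathcal{D}_-=\langle\mathcal{L}^2(\mathbb{R}_-),0,0\rangle$ and $\mathcal{D}_+=\langle0,0,\mathcal{L}^2(\mathbb{R}_+)\rangle$.
   Context: Let $0<q<1$ and $q^{\mathbb{Z}}=\{q^n:n\in\mathbb{Z}\}$. For a complex function $f$ on $q^{\mathbb{Z}}$ put $D_qf(t)=\frac{f(qt)-f(t)}{t(q-1)}$ and $D_{q^{-1}}f(t)=\frac{f(t)-f(q^{-1}t)}{t(1-q^{-1})}$, $t\in q^{\mathbb{Z}}$. The Jackson integral over $(0,\infty)$ is $\int_0^\infty f(t)\,d_qt=(1-q)\sum_{n\in\mathbb{Z}}q^nf(q^n)$. A function $f$ on $q^{\mathbb{Z}}$ is $q$-regular at zero if $f(0):=\lim_{n\to\infty}f(q^n)$ exists and is finite. $\mathcal{L}_{q}^{2}(q^{\mathbb{Z}};\mathbb{C}^{2})$ is the Hilbert space of functions $f:q^{\mathbb{Z}}\to\mathbb{C}^2$ with $\int_0^\infty\|f(t)\|_{\mathbb{C}^2}^2\,d_qt<\infty$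 and inner product $(f,g)=\int_0^\infty(f(t),g(t))_{\mathbb{C}^2}\,d_qt$. Let $p,r:q^{\mathbb{Z}}\to\mathbb{R}$ be $q$-regular at zero with $p(t)\ne0$, $r(t)\ne0$ for all $t\in q^{\mathbb{Z}}$. For $y=(y_1,y_2)^T$ set $$(l_1y)(t)=\begin{pmatrix}-\frac1q D_{q^{-1}}y_2(t)+p(t)y_1(t)\\ D_qy_1(t)+r(t)y_2(t)\end{pmatrix}.$$ $D_{max}$ is the set of all $y=(y_1,y_2)^T\in\mathcal{L}_{q}^{2}(q^{\mathbb{Z}};\mathbb{C}^{2})$ such that $y_1,y_2$ are $q$-regular at zero and $l_1y\in\mathcal{L}_{q}^{2}(q^{\mathbb{Z}};\mathbb{C}^{2})$; for such $y$, $y_i(0)=\lim_{n\to\infty}y_i(q^n)$. Put $[y,z](t)=y_1(t)\overline{z_2(q^{-1}t)}-\overline{z_1(t)}\,y_2(q^{-1}t)$. For this system the limit-point case holds at infinity: $\lim_{n\to\infty}[y,z](q^{-n})=0$ for all $y,z\in D_{max}$. $\mathbb{R}_-=(-\infty,0]$, $\mathbb{R}_+=[0,\infty)$; $\mathcal{W}_2^1(\mathbb{R}_\mp)$ is the Sobolev space of locally absolutely continuous $f\in\mathcal{L}^2(\mathbb{R}_\mp)$ with $f'\in\mathcal{L}^2(\mathbb{R}_\mp)$. Let $\delta>0$, $\delta^2=2\operatorname{Im}h$, and $\mathcal{H}=\mathcal{L}^2(\mathbb{R}_-)\oplus\mathcal{L}_{q}^{2}(q^{\mathbb{Z}};\mathbb{C}^{2})\oplus\mathcal{L}^2(\mathbb{R}_+)$.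 $M_h$ is the selfadjoint operator in $\mathcal{H}$ with domain consisting of all $\langle\phi_-,y,\phi_+\rangle$ with $\phi_\mp\in\mathcal{W}_2^1(\mathbb{R}_\mp)$, $y\in D_{max}$, $y_2(0)-h\,y_1(0)=\delta\phi_-(0)$, $y_2(0)-\overline{h}\,y_1(0)=\delta\phi_+(0)$, acting by $M_h\langle\phi_-,y,\phi_+\rangle=\langle i\phi_-',\,l_1y,\,i\phi_+'\rangle$. Titchmarsh-Weyl function: let $\phi(t,\lambda),\psi(t,\lambda)$ be the solutions of $(l_1y)(t)=\lambda y(t)$, $t\in q^{\mathbb{Z}}$, with $\phi_1(0,\lambda)=0$, $\phi_2(0,\lambda)=1$, $\psi_1(0,\lambda)=1$, $\psi_2(0,\lambda)=0$. For $\operatorname{Im}\lambda\neq0$, $m_\infty(\lambda)$ is the unique complex number with $\psi(\cdot,\lambda)+m_\infty(\lambda)\phi(\cdot,\lambda)\in\mathcal{L}_{q}^{2}(q^{\mathbb{Z}};\mathbb{C}^{2})$. It is holomorphic for $\operatorname{Im}\lambda\neq0$; ''meromorphic in $\mathbb{C}$'' means that it extends to a meromorphic function on $\mathbb{C}$ (still denoted $m_\infty$). Put $w(t,\lambda)=\psi(t,\lambda)+m_\infty(\lambda)\phi(t,\lambda)$. Spectral representations: for real $\lambda$ (expressions at real poles of $m_\infty$ being understood by continuity) let $$U_\lambda^-(t,\xi,\tau)=\big\langle e^{-i\lambda\xi},\ (m_\infty(\lambda)-h)^{-1}\delta\,w(t,\lambda),\ \overline{S_h(\lambda)}\,e^{-i\lambda\tau}\big\rangle,$$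 $$U_\lambda^+(t,\xi,\tau)=\big\langle S_h(\lambda)e^{-i\lambda\xi},\ (m_\infty(\lambda)-\overline{h})^{-1}\delta\,w(t,\lambda),\ e^{-i\lambda\tau}\big\rangle,$$ where $\xi\in\mathbb{R}_-$, $t\in q^{\mathbb{Z}}$, $\tau\in\mathbb{R}_+$. For $f=\langle\phi_-,y,\phi_+\rangle$ with compactly supported smooth $\phi_-,\phi_+$ and compactly supported $y$, define $(F_\pm f)(\lambda)=\frac1{\sqrt{2\pi}}(f,U_\lambda^\pm)_{\mathcal{H}}$, where $(\cdot,\cdot)_{\mathcal{H}}$ is the pairing given by the formula of the inner product of $\mathcal{H}$ (the $U_\lambda^\pm$ themselves are not in $\mathcal{H}$). The maps $F_\pm$ extend by continuity to unitary maps of $\mathcal{H}$ onto $L^2(\mathbb{R})$ that transform $U_h(s)$ into multiplication by $e^{i\lambda s}$, with $F_-\mathcal{D}_-=H^2_-$ and $F_+\mathcal{D}_+=H^2_+$ ($H^2_\pm$ the Hardy classes of the upper/lower half-plane); $F_-$ is the incoming and $F_+$ the outgoing spectral representation of $\{U_h(s)\}$. The scattering matrix (scattering function) of the group $\{U_h(s)\}$ with respect to $\mathcal{D}_-$ and $\mathcal{D}_+$ is the function $\Theta$ on $\mathbb{R}$ by which the $F_-$-representation of a vector must be multiplied to obtain its $F_+$-representation: $(F_+f)(\lambda)=\Theta(\lambda)(F_-f)(\lambda)$ for all $f\in\mathcal{H}$ and a.e. $\lambda\in\mathbb{R}$. *)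

(* Defs.v *)
From HB Require Import structures.
From mathcomp Require Import all_boot all_order all_algebra complex.
From mathcomp Require Import all_classical all_reals all_analysis.
From mathcomp Require summability.
Import Order.TTheory GRing.Theory Num.Theory numFieldNormedType.Exports.

Set Implicit Arguments.
Unset Strict Implicit.
Unset Printing Implicit Defensive.

Local Open Scope classical_set_scope.
Local Open Scope ring_scope.

(* [R[i]] packed as a [numClosedFieldType], so that the topology, norm and
   module structures of a numeric field over itself are inferred. *)
Definition Cplx (R : realType) : numClosedFieldType := R[i].

Definition toC (R : realType) (x : R) : Cplx R := (x%:C)%C.
Definition mkC (R : realType) (x y : R) : Cplx R := (x +i* y)%C.
Definition ReC (R : realType) (z : Cplx R) : R := complex.Re z.
Definition ImC (R : realType) (z : Cplx R) : R := complex.Im z.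
Definition absC (R : realType) (z : Cplx R) : R := ComplexField.Normc.normc z.

(* The generic ['i] of a [numClosedFieldType] is only a chosen root of [-1]. *)
Definition imC (R : realType) : Cplx R := mkC 0 1.
Definition expi (R : realType) (x : R) : Cplx R := mkC (cos x) (sin x).

(** Complex [L^2] spaces on subsets of the line. Elements are represented by
    functions on the whole line; only their values on [D] matter, up to a.e.
    equality. *)

Section L2.
Variable R : realType.
Implicit Types (D : set R) (f g : R -> Cplx R).

Definition Rminus : set R := [set x | x <= 0].
Definition Rplus : set R := [set x | 0 <= x].

Definition cmeasurable D f : Prop :=
  measurable_fun D (fun x => ReC (f x)) /\ measurable_fun D (fun x => ImC (f x)).

Definition cintegral D f : Cplx R :=
  mkC (Rintegral lebesgue_measure D (fun x => ReC (f x)))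
      (Rintegral lebesgue_measure D (fun x => ImC (f x))).

Definition L2norm2 D f : \bar R :=
  (\int[lebesgue_measure]_(x in D) (absC (f x) ^+ 2)%:E)%E.

Definition L2 D f : Prop := cmeasurable D f /\ (L2norm2 D f < +oo)%E.

Definition L2ip D f g : Cplx R := cintegral D (fun x => f x * (g x)^*).

Definition ae_eq_on D f g : Prop :=
  {ae lebesgue_measure, forall x : R, D x -> f x = g x}.

Definition abs_cont (a b : R) f : Prop :=
  forall e : R, 0 < e -> exists2 d : R, 0 < d &
    forall (n : nat) (s t : 'I_n -> R),
      (forall i, a <= s i /\ s i <= t i /\ t i <= b) ->
      (forall i j, i != j -> t i <= s j \/ t j <= s i) ->
      \sum_i (t i - s i) < d ->
      \sum_i absC (f (t i) - f (s i)) < e.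

Definition loc_abs_cont D f : Prop :=
  forall a b : R, a <= b -> `[a, b]%classic `<=` D -> abs_cont a b f.

Definition cderive f (x : R) : Cplx R :=
  mkC (derive1 (fun t => ReC (f t)) x) (derive1 (fun t => ImC (f t)) x).

Definition sobolev12 D f : Prop :=
  [/\ L2 D f, loc_abs_cont D f & L2 D (cderive f)].

(* Restricted to a closed half-line, these are the functions that are smooth up
   to the end point and compactly supported in the closed half-line. *)
Definition smooth_compact f : Prop :=
  (forall (k : nat) (x : R),
     derivable (derive1n k (fun t => ReC (f t))) x 1 /\
     derivable (derive1n k (fun t => ImC (f t))) x 1) /\
  (exists M : R, forall x, M < `|x| -> f x = 0).

(* Boundary values of the Hardy class of the half-plane [0 < s * Im z],
   for [s = 1] (upper half-plane) or [s = -1] (lower half-plane). *)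
Definition hardy2 (s : R) f : Prop :=
  L2 setT f /\
  exists G : Cplx R -> Cplx R,
    [/\ forall z, 0 < s * ImC z -> derivable G z 1,
        exists M : R, forall y : R, 0 < y ->
          (L2norm2 setT (fun x => G (mkC x (s * y))) <= M%:E)%E
      & {ae lebesgue_measure, forall x : R,
          G (mkC x (s * y)) @[y --> 0^'+] --> f x}].

End L2.

Section Meromorphic.
Variable R : realType.
Implicit Types (f : Cplx R -> Cplx R) (z : Cplx R).

Definition holomorphic_at f z : Prop := \forall w \near z, derivable f w 1.

Definition pole f z : Prop :=
  (\forall w \near z^', derivable f w 1) /\
  absC (f w) @[w --> z^'] --> +oo%R.

Definition meromorphic f : Prop := forall z, holomorphic_at f z \/ pole f z.

(* [e l], taken by continuity when [l] is a pole of [f]. *)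
Definition at_pole_by_continuity f (e : R -> Cplx R) (l : R) : Cplx R :=
  if `[< pole f (toC l) >] then lim (e x @[x --> l^']) else e l.

End Meromorphic.

(** A function on the lattice of integer powers of [q] is encoded by a function
    on [int]: [f n] stands for the value at the point [q ^ n]. *)

Section QCalculus.
Variables (R : realType) (q : R).
Implicit Types (f : int -> Cplx R) (y z : int -> Cplx R * Cplx R).

Definition Dq f (n : int) : Cplx R :=
  (f (n + 1) - f n) / toC (q ^ n * (q - 1)).

Definition Dqinv f (n : int) : Cplx R :=
  (f n - f (n - 1)) / toC (q ^ n * (1 - q^-1)).

Definition jackson f : Cplx R :=
  toC (1 - q) * summability.sum (fun n : int => toC (q ^ n) * f n).

Definition Lq2norm2 y : \bar R :=
  (\esum_(n in [set: int])
    ((1 - q) * q ^ n * (absC (y n).1 ^+ 2 + absC (y n).2 ^+ 2))%:E)%E.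

Definition Lq2 y : Prop := (Lq2norm2 y < +oo)%E.

Definition Lq2ip y z : Cplx R :=
  jackson (fun n => (y n).1 * ((z n).1)^* + (y n).2 * ((z n).2)^*).

Definition qregular (V : topologicalType) (f : int -> V) : Prop :=
  exists v : V, f n%:Z @[n --> \oo] --> v.

Definition at0 f : Cplx R := lim (f n%:Z @[n --> \oo]).

Definition comp1 y (n : int) : Cplx R := (y n).1.
Definition comp2 y (n : int) : Cplx R := (y n).2.

Variables p r : int -> R.

Definition l1 y (n : int) : Cplx R * Cplx R :=
  (- (toC q)^-1 * Dqinv (comp2 y) n + toC (p n) * comp1 y n,
   Dq (comp1 y) n + toC (r n) * comp2 y n).

Definition Dmax y : Prop :=
  [/\ Lq2 y, qregular (comp1 y), qregular (comp2 y) & Lq2 (l1 y)].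

Definition is_solution (l a b : Cplx R) y : Prop :=
  [/\ forall n, l1 y n = l *: y n,
      comp1 y n%:Z @[n --> \oo] --> a & comp2 y n%:Z @[n --> \oo] --> b].

(* [m] takes the Titchmarsh-Weyl values off the real axis; its values on the
   real axis are not constrained here. *)
Definition titchmarsh_weyl (phi psi : Cplx R -> int -> Cplx R * Cplx R)
    (m : Cplx R -> Cplx R) : Prop :=
  forall l, ImC l != 0 ->
    Lq2 (psi l + m l *: phi l) /\
    forall c : Cplx R, Lq2 (psi l + c *: phi l) -> c = m l.

End QCalculus.

(** The Hilbert space [L^2(R_-) (+) L_q^2 (+) L^2(R_+)]: triples [(phi-, y, phi+)]
    satisfying [inH], identified through [eqH]. *)

Definition Hsp (R : realType) : Type :=
  ((R -> Cplx R) * (int -> Cplx R * Cplx R) * (R -> Cplx R))%type.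

Section Hilbert.
Variables (R : realType) (q : R).
Implicit Types (f g : Hsp R) (U : R -> Hsp R -> Hsp R).

Definition inH f : Prop :=
  [/\ L2 (@Rminus R) f.1.1, Lq2 q f.1.2 & L2 (@Rplus R) f.2].

Definition eqH f g : Prop :=
  [/\ ae_eq_on (@Rminus R) f.1.1 g.1.1, f.1.2 =1 g.1.2
    & ae_eq_on (@Rplus R) f.2 g.2].

Definition Hnorm2 f : \bar R :=
  (L2norm2 (@Rminus R) f.1.1 + Lq2norm2 q f.1.2 + L2norm2 (@Rplus R) f.2)%E.

Definition Hip f g : Cplx R :=
  L2ip (@Rminus R) f.1.1 g.1.1 + Lq2ip q f.1.2 g.1.2
  + L2ip (@Rplus R) f.2 g.2.

Definition incoming_space f : Prop :=
  exists2 u, L2 (@Rminus R) u & f = (u, 0, 0).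

Definition outgoing_space f : Prop :=
  exists2 u, L2 (@Rplus R) u & f = (0, 0, u).

Record unitary_group U : Prop := UnitaryGroup {
  ug_inH : forall s f, inH f -> inH (U s f) ;
  ug_eqH : forall s f g, inH f -> inH g -> eqH f g -> eqH (U s f) (U s g) ;
  ug_linear : forall s (a : Cplx R) f g, inH f -> inH g ->
    eqH (U s (a *: f + g)) (a *: U s f + U s g) ;
  ug_isometry : forall s f, inH f -> Hnorm2 (U s f) = Hnorm2 f ;
  ug_0 : forall f, inH f -> eqH (U 0 f) f ;
  ug_add : forall s t f, inH f -> eqH (U (s + t) f) (U s (U t f)) ;
  ug_continuous : forall f, inH f -> Hnorm2 (U s f - f) @[s --> 0] --> 0%E }.

(* [U s = exp (i A s)] for an operator [A] given by its graph: [U] is the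
   strongly continuous unitary group whose infinitesimal generator, domain
   included, is [i A]. *)
Definition exp_group (A : Hsp R -> Hsp R -> Prop) U : Prop :=
  unitary_group U /\
  forall f g, inH f -> inH g ->
    (Hnorm2 (toC s^-1 *: (U s f - f) - g) @[s --> 0^'] --> 0%E <->
     exists k, A f k /\ eqH g (imC R *: k)).

Definition test_vector f : Prop :=
  [/\ smooth_compact f.1.1, finite_set [set n | f.1.2 n <> 0]
    & smooth_compact f.2].

(* [F] is the unitary map of [H] onto [L^2(R)] extending by continuity
   [f |-> (2 pi)^(-1/2) (f, E l)] from the test vectors, carrying [U s] to
   multiplication by [exp (i l s)] and the subspace [D] onto the class [K]. *)
Record spectral_representation U (D : Hsp R -> Prop) (K : (R -> Cplx R) -> Prop)
    (E : R -> Hsp R) (F : Hsp R -> R -> Cplx R) : Prop := SpectralRepresentation {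
  sr_L2 : forall f, inH f -> L2 setT (F f) ;
  sr_eqH : forall f g, inH f -> inH g -> eqH f g -> ae_eq_on setT (F f) (F g) ;
  sr_linear : forall (a : Cplx R) f g, inH f -> inH g ->
    ae_eq_on setT (F (a *: f + g)) (a *: F f + F g) ;
  sr_isometry : forall f, inH f -> L2norm2 setT (F f) = Hnorm2 f ;
  sr_onto : forall u, L2 setT u -> exists2 f, inH f & ae_eq_on setT (F f) u ;
  sr_formula : forall f, test_vector f ->
    ae_eq_on setT (F f) (fun l => toC (Num.sqrt (2 * pi))^-1 * Hip f (E l)) ;
  sr_group : forall s f, inH f ->
    ae_eq_on setT (F (U s f)) (fun l => expi (l * s) * F f l) ;
  sr_image : forall u, L2 setT u ->
    (K u <-> exists2 f, D f & ae_eq_on setT (F f) u) }.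

(* [T] is the scattering function relating the incoming representation [Fm] to
   the outgoing representation [Fp]. *)
Definition scattering_matrix (Fm Fp : Hsp R -> R -> Cplx R) (T : R -> Cplx R)
    : Prop :=
  forall f, inH f -> ae_eq_on setT (Fp f) (fun l => T l * Fm f l).

End Hilbert.

Section Dilation.
Variables (R : realType) (q : R) (p r : int -> R) (h : Cplx R) (delta : R).

Definition Mh_domain (f : Hsp R) : Prop :=
  [/\ sobolev12 (@Rminus R) f.1.1, sobolev12 (@Rplus R) f.2,
      Dmax q p r f.1.2,
      at0 (comp2 f.1.2) - h * at0 (comp1 f.1.2) = toC delta * f.1.1 0
    & at0 (comp2 f.1.2) - h^* * at0 (comp1 f.1.2) = toC delta * f.2 0].

Definition Mh_act (f : Hsp R) : Hsp R :=
  (imC R *: cderive f.1.1, l1 q p r f.1.2, imC R *: cderive f.2).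

(* [Mh_domain] constrains the locally absolutely continuous representatives;
   the graph is then closed under a.e. equality. *)
Definition Mh (f g : Hsp R) : Prop :=
  exists f0, [/\ eqH f f0, Mh_domain f0 & eqH g (Mh_act f0)].

Variables (phi psi : Cplx R -> int -> Cplx R * Cplx R) (m : Cplx R -> Cplx R).

Definition S_fun (l : R) : Cplx R :=
  at_pole_by_continuity m
    (fun x => (m (toC x) - h) / (m (toC x) - h^*)) l.

(* The middle component [(m - c)^-1 delta w(., l)] of the eigenfunctions. *)
Definition weyl_part (c : Cplx R) (l : R) (n : int) : Cplx R * Cplx R :=
  let v x := (m (toC x) - c)^-1
               *: (toC delta *: (psi (toC x) n + m (toC x) *: phi (toC x) n)) in
  (at_pole_by_continuity m (fun x => (v x).1) l,
   at_pole_by_continuity m (fun x => (v x).2) l).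

Definition U_minus (l : R) : Hsp R :=
  (fun xi => expi (- (l * xi)), weyl_part h l,
   fun tau => (S_fun l)^* * expi (- (l * tau))).

Definition U_plus (l : R) : Hsp R :=
  (fun xi => S_fun l * expi (- (l * xi)), weyl_part h^* l,
   fun tau => expi (- (l * tau))).

End Dilation.

(* Main.v *)
Require Import Defs.
From HB Require Import structures.
From mathcomp Require Import all_boot all_order all_algebra complex finmap.
From mathcomp Require Import all_classical all_reals all_analysis.
From mathcomp Require Import measurable_realfun ring lra.
From mathcomp Require summability.
Import Order.TTheory GRing.Theory Num.Theory numFieldNormedType.Exports.
Local Open Scope classical_set_scope.
Local Open Scope ring_scope.

(* For every real [l] one has [U_plus l = S_h(l) U_minus l]: the middle components
   differ by the factor [(m - h) / (m - h^* )], and the outer ones do so because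
   [|S_h(l)| = 1]. The latter holds because [m] is real on the real axis away from
   its poles: [m (l^* ) = (m l)^*] off the axis, since the solutions of the
   q-difference system are determined by their values at zero, so that [phi] and
   [psi] commute with conjugation. At a pole, [S_h] tends to [1].
   Pairing with [U_plus l] is conjugate linear, so [F_+ f = S_h^* F_- f] for every
   test vector [f]. Both sides being isometric in [f], it remains to see that
   the test vectors span a dense subspace. Bump functions tend to the indicators
   of bounded open intervals under domination, Dynkin's pi-lambda theorem gives the
   indicators of bounded Borel sets, hence simple functions and finally all of
   [L^2]; on the lattice, finitely supported functions are dense. *)

Set Implicit Arguments.
Unset Strict Implicit.

(** * Complex numbers *)

Section CplxFacts.
Variable R : realType.
Implicit Types (x y : R) (z w : Cplx R).

Lemma conjCE z : z^* = mkC (ReC z) (- ImC z).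
Proof. by case: z. Qed.

Lemma normCplx z : `|z| = toC (absC z).
Proof. by rewrite normc_def; case: z. Qed.

Lemma absC2 z : absC z ^+ 2 = ReC z ^+ 2 + ImC z ^+ 2.
Proof. by case: z => a b; rewrite /absC /= sqr_sqrtr // addr_ge0 ?sqr_ge0. Qed.

Lemma absC_ge0 z : 0 <= absC z.
Proof. by case: z => a b; rewrite /absC /= sqrtr_ge0. Qed.

Lemma ltCR x y : (toC x < toC y) = (x < y).
Proof. exact: ltcR. Qed.

Lemma absCD z w : absC (z + w) <= absC z + absC w.
Proof. exact: le_normcD. Qed.
Lemma absCM z w : absC (z * w) = absC z * absC w.
Proof. by apply: (@complexI R); rewrite rmorphM /= -![(_)%:C%C]normCplx normrM. Qed.
Lemma absCN z : absC (- z) = absC z.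
Proof. exact: normcN. Qed.
Lemma absCJ z : absC z^* = absC z.
Proof. by case: z => a b; rewrite /absC /= sqrrN. Qed.
Lemma absC_eq0 z : absC z = 0 -> z = 0.
Proof. exact: ComplexField.Normc.eq0_normc. Qed.
Lemma absC_toC x : absC (toC x) = `|x|.
Proof. by rewrite /absC /= expr0n addr0 sqrtr_sqr. Qed.
Lemma absC0 : absC (0 : Cplx R) = 0.
Proof. by rewrite (absC_toC 0) normr0. Qed.
Lemma absC2_pair0 :
  absC (0 : Cplx R * Cplx R).1 ^+ 2 + absC (0 : Cplx R * Cplx R).2 ^+ 2 = 0.
Proof.
by rewrite -[LHS]/(absC (0 : Cplx R) ^+ 2 + absC (0 : Cplx R) ^+ 2) absC0 expr0n addr0.
Qed.
Lemma toCM x y : toC (x * y) = toC x * toC y.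
Proof. exact: rmorphM. Qed.
Lemma toCD x y : toC (x + y) = toC x + toC y.
Proof. exact: rmorphD. Qed.
Lemma toCN x : toC (- x) = - toC x.
Proof. exact: rmorphN. Qed.
Lemma toCV x : toC x^-1 = (toC x)^-1.
Proof. exact: fmorphV. Qed.
Lemma conj_toC x : (toC x)^* = toC x.
Proof. by rewrite conjCE /mkC /= oppr0. Qed.

(** The topology of [Cplx R] takes its radii in [Cplx R] itself; a positive radius is real there, so
    convergence can be tested on the real-valued modulus. *)
Lemma cvg_absCP (T : Type) (F : set_system T) {FF : Filter F} (f : T -> Cplx R) (l : Cplx R) :
  f @ F --> l <-> (absC (f x - l)) @[x --> F] --> (0 : R).
Proof.
split.
- move=> /cvgrPdist_lt fl; apply/cvgrPdist_lt => e e0.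
  have := fl (toC e); rewrite ltCR => /(_ e0); apply: filterS => t.
  by rewrite normCplx ltCR sub0r normrN (ger0_norm (absC_ge0 _)) -absCN opprB.
- move=> /cvgrPdist_lt fl; apply/cvgrPdist_lt => e e0.
  have e1 : e = toC (ReC e) by case: e e0 => a b; rewrite ltcE /= => /andP[/eqP -> _].
  have e2 : 0 < ReC e by rewrite -ltCR -e1.
  have := fl _ e2; apply: filterS => t.
  by rewrite sub0r normrN normCplx {2}e1 ltCR (ger0_norm (absC_ge0 _)) -absCN opprB.
Qed.

End CplxFacts.

(** * Solutions of the q-difference system *)

Section Solutions.
Variables (R : realType) (q : R) (p r : int -> R).
Hypotheses (q0 : 0 < q) (q1 : q < 1).
Implicit Types (y z : int -> Cplx R * Cplx R) (l a b : Cplx R).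

Definition conjp (v : Cplx R * Cplx R) : Cplx R * Cplx R := (v.1^*, v.2^*).

(** The coefficients of the system, [q ^ n], [p] and [r], are real. *)
Lemma l1_conj y n : l1 q p r (fun k => conjp (y k)) n = conjp (l1 q p r y n).
Proof.
rewrite /l1 /conjp /Dq /Dqinv /comp1 /comp2 /=.
by rewrite !(rmorphB, rmorphD, rmorphM, rmorphN, fmorphV) /= !conj_toC.
Qed.

Lemma cvg_conj (T : Type) (F : set_system T) {FF : Filter F} (f : T -> Cplx R) l :
  f @ F --> l -> (f x)^* @[x --> F] --> l^*.
Proof.
move=> /cvg_absCP h; apply/cvg_absCP.
by under eq_fun do rewrite -rmorphB absCJ.
Qed.

Lemma is_solution_conj l a b y : is_solution q p r l a b y ->
  is_solution q p r l^* a^* b^* (fun k => conjp (y k)).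
Proof.
case=> h1 h2 h3; split.
- move=> n; rewrite l1_conj h1 /conjp /=.
  by congr pair; rewrite rmorphM.
- exact: cvg_conj h2.
- exact: cvg_conj h3.
Qed.

Lemma l1B y z n : l1 q p r (fun k => y k - z k) n = l1 q p r y n - l1 q p r z n.
Proof.
rewrite /l1 /Dq /Dqinv /comp1 /comp2 /=.
by congr pair; rewrite /=; ring.
Qed.

Lemma is_solutionB l a b a' b' y z : is_solution q p r l a b y ->
  is_solution q p r l a' b' z ->
  is_solution q p r l (a - a') (b - b') (fun k => y k - z k).
Proof.
case=> h1 h2 h3 [k1 k2 k3]; split.
- by move=> n; rewrite l1B h1 k1 scalerBr.
- exact: cvgB h2 k2.
- exact: cvgB h3 k3.
Qed.

(** The two equations are solved in the direction away from zero: [y1 (n + 1)] and [y2 n] give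
    [y1 n], and then [y1 n] and [y2 n] give [y2 (n - 1)]. *)
Lemma is_solution_rec l a b y : is_solution q p r l a b y -> forall n,
  (y n).1 = (y (n + 1)).1 - toC (q ^ n * (q - 1)) * (l - toC (r n)) * (y n).2 /\
  (y (n - 1)).2 = (y n).2 - toC (q ^ n * (q - 1)) * (toC (p n) - l) * (y n).1.
Proof.
case=> h _ _ n.
have [qn0 qd0] : q ^ n != 0 /\ q - 1 != 0.
  by split; [rewrite expfz_neq0 ?gt_eqF | rewrite subr_eq0 lt_eqF].
have c0 : toC (q ^ n * (q - 1)) != 0.
  by apply/eqP => /(@complexI R _ 0)/eqP; rewrite mulf_eq0 (negPf qn0) (negPf qd0).
have := h n; case=> /=; rewrite /Dq /Dqinv /comp1 /comp2 => e1 e2.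
rewrite -2!(mulrA (toC _)); split.
- have -> : (l - toC (r n)) * (y n).2 = ((y (n+1)).1 - (y n).1) / toC (q ^ n * (q - 1)).
    rewrite mulrBl; apply/eqP; rewrite subr_eq; apply/eqP.
    by rewrite -[l * _]/(l *: (y n).2) -e2.
  by rewrite mulrC divfK // subKr.
(* The factor [1/q] in front of [Dqinv] turns its denominator into that of [Dq], so both equations
   share the coefficient [q ^ n * (q - 1)]. *)
have e3 : - (toC q)^-1 / toC (q ^ n * (1 - q^-1)) = - (toC (q ^ n * (q - 1)))^-1.
  rewrite mulNr -!toCV -toCM; congr (- toC _).
  have q00 : q != 0 by rewrite gt_eqF.
  by field; rewrite q00 qn0 qd0.
have -> : (toC (p n) - l) * (y n).1 = ((y n).2 - (y (n-1)).2) / toC (q ^ n * (q - 1)).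
  rewrite mulrBl -[l * _]/(l *: (y n).1) -e1.
  rewrite [X in _ - (X + _)](_ : _ = - ((y n).2 - (y (n-1)).2) / toC (q ^ n * (q - 1))).
    by ring.
  by rewrite mulrCA e3; ring.
by rewrite mulrC divfK // subKr.
Qed.

Hypotheses (hp : qregular p) (hr : qregular r).

Lemma qregular_bounded (f : int -> R) : qregular f ->
  exists2 C : R, 0 <= C & forall n : nat, `|f n%:Z| <= C.
Proof.
case=> v fv.
have /cvg_seq_bounded [M [_ hM]] : cvgn (fun n : nat => f n%:Z).
  by apply/cvg_ex; exists v.
have hM' n : `|f n%:Z| <= M + 1 by apply: (hM (M + 1)); rewrite ?ltrDl.
by exists (M + 1) => //; rewrite (le_trans _ (hM' 0%N)).
Qed.

(** To be used with [x = q ^ n]; the factor [q - 1] has modulus at most 1. *)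
Lemma absC_le_recurrence (a b c g : Cplx R) (M x : R) :
  0 <= x -> a = b - toC (x * (q - 1)) * c * g ->
  absC c <= M -> absC a <= absC b + M * x * absC g.
Proof.
move=> x0 -> cM; apply: (le_trans (absCD _ _)); rewrite absCN lerD2l.
rewrite !absCM; apply: ler_wpM2r; first exact: absC_ge0.
rewrite mulrC ler_pM ?absC_ge0 // absC_toC normrM (ger0_norm x0).
by rewrite ler_piMr // ler_norml; have := q0; have := q1; move=> *; apply/andP; split; lra.
Qed.

(* Reading the recurrence from [q ^ (n+1)] to [q ^ n] multiplies the size [X n] of
   the solution by at most [expR (2 C q^n)]. As
   [2 C q^n = c q^n - c q^(n+1)], the weighted size [X n * expR (- c q^n)] is
   nondecreasing in [n], and it tends to [0]. *)
Lemma is_solution0 l y : is_solution q p r l 0 0 y -> forall n, y n = 0.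
Proof.
move=> ysol; have rec := is_solution_rec ysol.
have [Cp Cp0 hCp] := qregular_bounded hp.
have [Cr Cr0 hCr] := qregular_bounded hr.
pose C := absC l + Cp + Cr.
have C0 : 0 <= C by rewrite !addr_ge0 // absC_ge0.
have hlr n : absC (l - toC (r n%:Z)) <= C.
  rewrite (le_trans (absCD _ _)) // absCN absC_toC /C addrAC.
  by rewrite (le_trans (lerD (lexx _) (hCr n))) // lerDl.
have hpl n : absC (toC (p n%:Z) - l) <= C.
  rewrite (le_trans (absCD _ _)) // absCN absC_toC addrC /C.
  by rewrite -addrA lerD2l (le_trans (hCp n)) // lerDl.
(* The second component is read one point further from zero, so that one turn of the recurrence
   leads from [X n.+1] to [X n]. *)
pose X (n : nat) : R := absC (y n%:Z).1 + absC (y (n%:Z - 1)).2.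
pose c := 2 * C / (1 - q).
pose Z n := X n * expR (- (c * q ^+ n)).
have X0 n : 0 <= X n by rewrite addr_ge0 // absC_ge0.
have XS n : X n <= X n.+1 * expR (2 * C * q ^+ n).
  have [e1 e2] := rec n%:Z.
  have qn0 : 0 <= q ^+ n by rewrite exprn_ge0 // ltW.
  have := absC_le_recurrence qn0 e1 (hlr n).
  have := absC_le_recurrence qn0 e2 (hpl n).
  have -> : n%:Z + 1 = n.+1%:Z by rewrite -addn1 PoszD.
  rewrite /X; have -> : n.+1%:Z - 1 = n%:Z by rewrite -addn1 PoszD addrK.
  set a := absC _; set b := absC _; set a' := absC _; set b' := absC _.
  set u := C * q ^+ n => hb ha.
  have u0 : 0 <= u by rewrite mulr_ge0.
  have b0 : 0 <= b by exact: absC_ge0.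
  have a'0 : 0 <= b' by exact: absC_ge0.
  have -> : 2 * C * q ^+ n = u + u by rewrite /u; ring.
  (* Computing [y1 n] costs a factor [1 + u], and computing [y2 (n - 1)], which uses the new [y1 n],
     a second one; each is at most [expR u]. *)
  rewrite expRD mulrA; have e := expR_ge1Dx u.
  have : (b' + b) * (1 + u) * (1 + u) <= (b' + b) * expR u * expR u.
    by rewrite !ler_pM ?mulr_ge0 ?addr_ge0.
  apply: le_trans; nra.
have ZS n : Z n <= Z n.+1.
  rewrite /Z; apply: (le_trans (ler_wpM2r _ (XS n))); first exact: expR_ge0.
  rewrite -(mulrA (X _)) -expRD.
  rewrite (_ : 2 * C * q ^+ n + _ = - (c * q ^+ n.+1)) //.
  have q10 : 1 - q != 0 by rewrite subr_eq0 gt_eqF.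
  by rewrite /c exprS; field.
have Xcvg : X @ \oo --> (0 : R).
  have [_ h1 h2] := ysol.
  pose f n := absC (y n%:Z).1; pose g n := absC (y n%:Z).2.
  have hf : [sequence f n.+1]_n @ \oo --> (0 : R).
    by rewrite cvg_shiftS; have /cvg_absCP := h1; under eq_fun do rewrite subr0.
  have hg : g @ \oo --> (0 : R).
    by have /cvg_absCP := h2; under eq_fun do rewrite subr0.
  rewrite -(cvg_shiftS X) (_ : [sequence X n.+1]_n = [sequence f n.+1]_n \+ g).
    have h : ([sequence f n.+1]_n \+ g) x @[x --> \oo] --> (0 + 0 : R) by exact: cvgD.
    by rewrite addr0 in h.
  by apply/funext => n; rewrite /X /= -addn1 PoszD addrK.
have Zle n : Z n <= 0.
  rewrite -(cvg_lim (@Rhausdorff R) Xcvg); apply: limr_ge.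
    by apply/cvg_ex; exists 0.
  exists n => // k /= nk; apply: (@le_trans _ _ (Z k)).
    by apply: (@homo_leq _ _ <=%R) nk => //; apply: le_trans.
  rewrite /Z ler_piMr // -expR0 ler_expR oppr_le0 mulr_ge0 ?exprn_ge0 ?(ltW q0) //.
  by rewrite divr_ge0 ?subr_ge0 ?(ltW q1) // mulr_ge0.
have y0 (n : nat) : (y n%:Z).1 = 0 /\ (y (n%:Z - 1)).2 = 0.
  have : X n <= 0 by rewrite -(pmulr_lle0 _ (expR_gt0 (- (c * q ^+ n)))) Zle.
  rewrite /X => h; have := absC_ge0 (y n%:Z).1; have := absC_ge0 (y (n%:Z - 1)).2.
  by move=> h1 h2; split; apply: absC_eq0; apply/eqP; rewrite eq_le; apply/andP; split; lra.
(* The limit at zero settles the nonnegative indices. At the points [q ^ (- n)], where [p] and [r]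
   may be unbounded, the recurrence carries the zero values outwards. *)
have y0' (n : nat) : (y (- n%:Z)).1 = 0 /\ (y (- n%:Z - 1)).2 = 0.
  elim: n => [|n [IH1 IH2]]; first by rewrite oppr0; exact: (y0 0%N).
  have e : - n.+1%:Z = - n%:Z - 1 by rewrite -addn1 PoszD opprD.
  have [e1 e2] := rec (- n.+1%:Z).
  have z1 : (y (- n.+1%:Z)).1 = 0 by rewrite e1 {1}e subrK IH1 e IH2 mulr0 subr0.
  by split => //; rewrite e2 z1 e IH2 mulr0 subr0.
case=> n.
  rewrite (surjective_pairing (y n)); have [-> _] := y0 n.
  by have := (y0 n.+1).2; rewrite -addn1 PoszD addrK => ->.
rewrite NegzE (surjective_pairing (y _)); have [-> _] := y0' n.+1.
by have := (y0' n).2; rewrite -opprD -PoszD addn1 => ->.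
Qed.

Lemma solution_uniq l a b y z : is_solution q p r l a b y ->
  is_solution q p r l a b z -> y =1 z.
Proof.
move=> hy hz n; apply/eqP; rewrite -subr_eq0; apply/eqP.
by apply: (@is_solution0 l (fun k => y k - z k)); have := is_solutionB hy hz; rewrite !subrr.
Qed.

Lemma Lq2_conj y : Lq2 q y -> Lq2 q (fun n => conjp (y n)).
Proof.
rewrite /Lq2 /Lq2norm2; set a := esum _ _; set b := esum _ _; suff -> : b = a by [].
by apply: eq_esum => n _; rewrite /= !absCJ.
Qed.

(** Conjugation turns the square-integrable solution at [l] into one at [l^*] whose coefficient is
    [(m l)^*]; uniqueness of the Weyl coefficient identifies it with [m l^*]. *)
Lemma titchmarsh_weyl_conj phi psi m :
  (forall l, is_solution q p r l 0 1 (phi l)) ->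
  (forall l, is_solution q p r l 1 0 (psi l)) ->
  titchmarsh_weyl q phi psi m -> forall l, ImC l != 0 -> m l^* = (m l)^*.
Proof.
move=> hphi hpsi hm l l0.
have l0' : ImC l^* != 0 by rewrite conjCE oppr_eq0.
have [_ u] := hm _ l0'; symmetry; apply: u.
have [w _] := hm _ l0.
have := Lq2_conj w; congr Lq2; apply/funext => n.
have hphi' := is_solution_conj (hphi l); have hpsi' := is_solution_conj (hpsi l).
rewrite conjC0 conjC1 in hphi' hpsi'.
rewrite -[RHS]/(psi l^* n + (m l)^* *: phi l^* n).
rewrite (solution_uniq (hphi _) hphi') (solution_uniq (hpsi _) hpsi') /conjp /=.
by rewrite !rmorphD !rmorphM.
Qed.

End Solutions.

(** * The Titchmarsh-Weyl function on the real axis *)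

Section WeylFunction.
Variables (R : realType) (h : Cplx R) (m : Cplx R -> Cplx R).
Hypothesis h0 : 0 < ImC h.
Hypothesis mconj : forall l, ImC l != 0 -> m l^* = (m l)^*.

(** For [s = 1] the real point is approached from the upper half-plane, for [s = -1] from the lower
    one. *)
Lemma cvg_vertical (x s : R) : mkC x (s * t) @[t --> (0 : R)^'+] --> toC x.
Proof.
apply/cvg_absCP.
have -> : (fun t => absC (mkC x (s * t) - toC x)) = (fun t => `|s| * `|t|).
  apply/funext => t; rewrite /mkC /toC /absC /= subrr oppr0 addr0.
  by rewrite expr0n add0r sqrtr_sqr normrM.
have t0 : t @[t --> (0 : R)^'+] --> (0 : R) by apply: cvg_at_right_filter; exact: cvg_id.
have h1 : `|s| * `|t| @[t --> (0 : R)^'+] --> `|s| * `|0 : R| by apply: cvgMr; exact: cvg_norm.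
by rewrite normr0 mulr0 in h1.
Qed.

(* [m (x + i t)] and [m (x - i t)] are conjugate and have the same limit. *)
Lemma weyl_real (x : R) : derivable m (toC x) 1 -> (m (toC x))^* = m (toC x).
Proof.
move=> /derivable1_diffP /differentiable_continuous mc.
have cm s : m (mkC x (s * t)) @[t --> (0 : R)^'+] --> m (toC x).
  exact: (cvg_comp (fun t => mkC x (s * t)) m (@cvg_vertical x s) mc).
have c1 := cm 1; have c2 := cm (-1).
have c3 : (m (mkC x (1 * t)))^* @[t --> (0 : R)^'+] --> (m (toC x))^* by exact: cvg_conj.
have E : \forall t \near (0 : R)^'+, (m (mkC x (1 * t)))^* = m (mkC x (-1 * t)).
  near=> t; have t0 : 0 < t by near: t; exact: nbhs_right_gt.
  by rewrite -mconj ?conjCE //= mul1r ?mulN1r // gt_eqF.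
have c4 : (m (mkC x (1 * t)))^* @[t --> (0 : R)^'+] --> m (toC x).
  by apply: cvg_trans c2; apply: near_eq_cvg; apply: filterS E => t ->.
exact: (cvg_unique (@norm_hausdorff _ (Cplx R)) c3 c4).
Unshelve. all: end_near.
Qed.

Lemma real_sub_neq0 (M c : Cplx R) : M^* = M -> ImC c != 0 -> M - c != 0.
Proof.
move=> Mr; apply: contra => /eqP/subr0_eq Mc; move: Mr; rewrite Mc.
by case: c {Mc} => a b; rewrite conjCE => -[] bb; apply/eqP; rewrite /ImC /= in bb *; lra.
Qed.

Let sfun (x : R) := (m (toC x) - h) / (m (toC x) - h^*).

Lemma ImC_h : ImC h != 0. Proof. by rewrite gt_eqF. Qed.
Lemma ImC_hJ : ImC h^* != 0. Proof. by rewrite conjCE /= oppr_eq0 gt_eqF. Qed.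

(** As [m] is real at such a point, numerator and denominator of [sfun] are conjugate, and they do
    not vanish because [h] is not real. *)
Lemma sfun_unimodular (x : R) : derivable m (toC x) 1 -> sfun x * (sfun x)^* = 1.
Proof.
move=> /weyl_real Mr; have n1 := real_sub_neq0 Mr ImC_h; have n2 := real_sub_neq0 Mr ImC_hJ.
rewrite /sfun rmorphM fmorphV !rmorphB /= conjCK Mr.
by rewrite mulrACA mulrA mulfK // divff.
Qed.

Lemma toC_continuous : continuous (@toC R).
Proof.
move=> l; apply/cvg_absCP; under eq_fun do rewrite -toCN -toCD absC_toC.
have xl : x - l @[x --> l] --> (0 : R).
  by rewrite -(subrr l); apply: cvgB; [exact: cvg_id | exact: cvg_cst].
have h1 : `|x - l| @[x --> l] --> `|0 : R| by exact: cvg_norm.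
by rewrite normr0 in h1.
Qed.

(** Transfers what holds around a complex pole to the punctured real line; injectivity of [toC]
    keeps the centre out. *)
Lemma toC_cvg_dnbhs (l : R) : toC x @[x --> l^'] --> (toC l)^'.
Proof.
by apply: continuous_injective_withinNx; [exact: toC_continuous | move=> y /(@complexI R)].
Qed.

Lemma pole_sfun_cvg (l : R) : pole m (toC l) -> sfun x @[x --> l^'] --> (1 : Cplx R).
Proof.
case=> md minf.
have minf' : absC (m (toC x)) @[x --> l^'] --> +oo%R.
  exact: (cvg_comp _ _ (@toC_cvg_dnbhs l) minf).
have md' := @toC_cvg_dnbhs l _ md.
apply/cvg_absCP/cvgrPdist_lt => e e0.
near=> x.
have dx : derivable m (toC x) 1 by near: x; exact: md'.
have Mr := weyl_real dx; have n2 := real_sub_neq0 Mr ImC_hJ.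
(* This threshold forces the modulus of [m - h^*] above [absC (h^* - h) / e]. *)
have big : absC h + absC (h^* - h) / e < absC (m (toC x)).
  near: x; exact: ((@cvgryPgt _ _ _ _ _).1 minf' _).
rewrite sub0r normrN (ger0_norm (absC_ge0 _)).
have -> : sfun x - 1 = (h^* - h) / (m (toC x) - h^*).
  by rewrite /sfun -[1](divff n2) -mulrBl; congr (_ / _); ring.
set d := m _ - _ in n2 *.
have d0 : 0 < absC d.
  by rewrite lt_neqAle absC_ge0 andbT eq_sym; apply: contra n2 => /eqP/absC_eq0/eqP.
have aJ : absC (h^* - h) / absC d < e.
  rewrite ltr_pdivrMr // mulrC -ltr_pdivrMr //.
  have : absC (m (toC x)) <= absC d + absC h.
    by rewrite -(absCJ h) (le_trans _ (absCD _ _)) // /d subrK.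
  by move: big; move: (absC _) (absC _ / e) (absC d) => a b c; lra.
rewrite (le_lt_trans _ aJ) //; have := absCM ((h^* - h) / d) d.
by rewrite divfK // => ->; rewrite mulfK // gt_eqF.
Unshelve. all: end_near.
Qed.

(* Without assuming convergence: if one of the limits does not exist, neither does
   the other one, and both [lim] are the same default value. *)
Lemma lim_mul_cvg1 (T : Type) (F : set_system T) {FF : ProperFilter F} (s v w : T -> Cplx R) :
  s @ F --> (1 : Cplx R) -> (\forall x \near F, w x = s x * v x) -> lim (w @ F) = lim (v @ F).
Proof.
move=> s1 wv; congr (get _); apply/funext => L0; apply/propext.
rewrite /=; pose L : Cplx R := L0; suff : (w @ F --> L) <-> (v @ F --> L) by [].
move: L => {L0} L; split.
- move=> wL.
  have sV : (s x)^-1 @[x --> F] --> (1 : Cplx R)^-1 .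
    by apply: cvgV s1; exact: oner_neq0.
  have h' : (s x)^-1 * w x @[x --> F] --> (1 : Cplx R)^-1 * L by exact: (cvgM sV wL).
  rewrite invr1 mul1r in h'.
  apply: cvg_trans h'; apply: near_eq_cvg; near=> x.
  have -> : w x = s x * v x by near: x.
  rewrite mulKf //; near: x.
  have := s1; move=> /cvgr_neq0; apply; exact: oner_neq0.
- move=> vL; have h' : s x * v x @[x --> F] --> (1 : Cplx R) * L by exact: (cvgM s1 vL).
  rewrite mul1r in h'; apply: cvg_trans h'.
  by apply: near_eq_cvg; near=> x; symmetry; near: x.
Unshelve. all: end_near.
Qed.

(** * The scattering function and the middle components of the eigenfunctions *)

Section Eigenfunctions.
Hypothesis mmero : meromorphic m.
Variables (delta : R) (phi psi : Cplx R -> int -> Cplx R * Cplx R).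

Lemma not_pole_derivable l : ~ pole m l -> derivable m l 1.
Proof. by move=> np; case: (mmero l) => // /nbhs_singleton. Qed.

Lemma pole_S_fun l : pole m (toC l) -> S_fun h m l = 1.
Proof.
move=> hp; rewrite /S_fun /at_pole_by_continuity; case: asboolP => // _.
exact: (cvg_lim (@norm_hausdorff _ _) (pole_sfun_cvg hp)).
Qed.

Lemma S_fun_unimodular l : S_fun h m l * (S_fun h m l)^* = 1.
Proof.
have [hp|hn] := pselect (pole m (toC l)).
  by rewrite pole_S_fun // conjC1 mulr1.
rewrite /S_fun /at_pole_by_continuity; case: asboolP => // _.
exact/sfun_unimodular/not_pole_derivable.
Qed.

Lemma weyl_part_S_fun l n :
  weyl_part delta phi psi m h^* l n = S_fun h m l *: weyl_part delta phi psi m h l n.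
Proof.
have sm (x : R) v : derivable m (toC x) 1 ->
    (m (toC x) - h^*)^-1 * v = sfun x * ((m (toC x) - h)^-1 * v).
  move=> dx; have Mr := weyl_real dx; have n2 := real_sub_neq0 Mr ImC_h.
  by rewrite /sfun [_ / _]mulrC -mulrA mulVKf.
rewrite /weyl_part /at_pole_by_continuity; case: asboolP => hp; last first.
  have hd := not_pole_derivable hp.
  rewrite /S_fun /at_pole_by_continuity; case: asboolP => // _.
  by congr pair; exact: sm.
rewrite pole_S_fun // scale1r.
have md : \forall x \near l^', derivable m (toC x) 1 := @toC_cvg_dnbhs l _ hp.1.
have E (f g : R -> Cplx R) : (forall x, derivable m (toC x) 1 -> f x = sfun x * g x) ->
    lim (f x @[x --> l^']) = lim (g x @[x --> l^']).
  move=> fg; apply: (lim_mul_cvg1 (pole_sfun_cvg hp)).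
  by near=> x; apply: fg; near: x.
refine (f_equal2 pair _ _).
- apply: E.
  move=> x dx.
  exact: sm.
- apply: E => x.
  exact: sm.
Unshelve. all: end_near.
Qed.

End Eigenfunctions.

End WeylFunction.

(** * Pairing with test vectors *)

(** [summability.sum] is a limit along the finite subsets of the lattice. Finite support makes the
    partial sums eventually constant, so the limit is an ordinary finite sum. *)
Lemma finite_support_jacksonZ (R : realType) (q : R) (c : Cplx R) (f : int -> Cplx R) :
  finite_set [set n | f n <> 0] ->
  jackson q (fun n => c * f n) = c * jackson q f.
Proof.
move=> fin.
have sumE (g : int -> Cplx R) : (forall n, f n = 0 -> g n = 0) ->
    summability.sum g = \sum_(n <- fset_set [set n | f n <> 0]) g n.
  move=> g0; rewrite /summability.sum.
  apply: (@lim_near_cst (Cplx R) (@norm_hausdorff _ (Cplx R)) _ _ summability.totally_filter).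
  exists (fset_set [set n | f n <> 0]) => // A /= sA.
  rewrite /summability.partial_sum (big_fset_incl _ sA).
    by rewrite big_seq_fsetE.
  move=> n _; rewrite in_fset_set // notin_setE /= => /contrapT; exact: g0.
rewrite /jackson (sumE (fun n => toC (q ^ n) * (c * f n))); last by move=> n ->; rewrite !mulr0.
rewrite (sumE (fun n => toC (q ^ n) * f n)); last by move=> n ->; rewrite mulr0.
rewrite mulrCA; congr (_ * _); rewrite mulr_sumr; apply: eq_bigr => n _.
by rewrite mulrCA.
Qed.

(* [lebesgue_measure] is a measure on [measurableTypeR R], not on [R] with its own
   (convertible) sigma-algebra, whence the type of the sets [D] below. *)
Section CompactSupport.
Variable R : realType.
Implicit Types (f g : R -> R) (u : R -> Cplx R) (D : set (measurableTypeR R)).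
Local Notation mu := (@lebesgue_measure R).

Lemma integrable_compact_support D f M : measurable D -> continuous f ->
  (forall x, M < `|x| -> f x = 0) -> mu.-integrable D (EFin \o f).
Proof.
move=> mD fc f0; apply: (@integrableS _ _ _ _ setT) => //.
have fI : EFin \o f = (EFin \o f) \_ `[- M, M].
  apply/funext => x; rewrite patchE; case: ifPn => //.
  rewrite notin_setE /= in_itv /= -ler_norml => /negP; rewrite -ltNge => /f0.
  by move=> /= ->.
rewrite fI; apply: (iffLR (integrable_mkcond _ _)) => //.
apply: continuous_compact_integrable; first exact: segment_compact.
exact: continuous_subspaceT.
Qed.

Lemma cintegralZ D (c : Cplx R) u : measurable D ->
  mu.-integrable D (EFin \o (fun x => ReC (u x))) ->
  mu.-integrable D (EFin \o (fun x => ImC (u x))) ->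
  cintegral D (fun x => c * u x) = c * cintegral D u.
Proof.
move=> mD iR iI; case: c => a b.
have E1 : (fun x => ReC ((a +i* b)%C * u x)) = (fun x => a * ReC (u x) - b * ImC (u x)).
  by apply/funext => x; case: (u x).
have E2 : (fun x => ImC ((a +i* b)%C * u x)) = (fun x => a * ImC (u x) + b * ReC (u x)).
  by apply/funext => x; case: (u x).
have iZ k (g : R -> R) : mu.-integrable D (EFin \o g) ->
    mu.-integrable D (EFin \o (fun x => k * g x)).
  by move=> ig; exact: (integrableZl mD k ig).
rewrite /cintegral E1 E2 (RintegralB mD (iZ _ _ iR) (iZ _ _ iI)).
by rewrite (RintegralD mD (iZ _ _ iI) (iZ _ _ iR)) !RintegralZl.
Qed.

Lemma smooth_compact_continuous u : smooth_compact u ->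
  continuous (fun x => ReC (u x)) /\ continuous (fun x => ImC (u x)).
Proof.
by case=> h _; split => x; have [h1 h2] := h 0%N x;
  apply: differentiable_continuous; apply/derivable1_diffP.
Qed.

(** The exponentials are not square integrable on a half-line; compact support of [u] provides the
    integrability under which the constant can be taken out. *)
Lemma L2ipZ D (c : Cplx R) u (l : R) : measurable D -> smooth_compact u ->
  L2ip D u (fun x => c * expi (- (l * x))) = c^* * L2ip D u (fun x => expi (- (l * x))).
Proof.
move=> mD us; have [c1 c2] := smooth_compact_continuous us; have [_ [M u0]] := us.
have lin : continuous (fun x => - (l * x)).
  by move=> x; apply: cvgN; apply: cvgMr; exact: cvg_id.
have cosl : continuous (fun x => cos (- (l * x))).
  by move=> x; apply: continuous_comp; [exact: lin | exact: continuous_cos].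
have sinl : continuous (fun x => sin (- (l * x))).
  by move=> x; apply: continuous_comp; [exact: lin | exact: continuous_sin].
rewrite /L2ip -cintegralZ //.
- by congr cintegral; apply/funext => x; rewrite rmorphM /=; ring.
- apply: (@integrable_compact_support _ _ M) => // [|x /u0 ->]; last by rewrite mul0r.
  have -> : (fun x => ReC (u x * (expi (- (l * x)))^*)) =
    (fun x => ReC (u x) * cos (- (l * x)) + ImC (u x) * sin (- (l * x))).
    by apply/funext => x; rewrite conjCE; case: (u x) => a b; rewrite /ReC /ImC /=; ring.
  by move=> x; apply: cvgD; apply: cvgM; [exact: c1|exact: cosl|exact: c2|exact: sinl].
- apply: (@integrable_compact_support _ _ M) => // [|x /u0 ->]; last by rewrite mul0r.
  have -> : (fun x => ImC (u x * (expi (- (l * x)))^*)) =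
    (fun x => ImC (u x) * cos (- (l * x)) - ReC (u x) * sin (- (l * x))).
    by apply/funext => x; rewrite conjCE; case: (u x) => a b; rewrite /ReC /ImC /=; ring.
  by move=> x; apply: cvgB; apply: cvgM; [exact: c2|exact: cosl|exact: c1|exact: sinl].
Qed.

End CompactSupport.

(** * Coincidence of isometries up to a unimodular factor *)

(** The triangle inequality followed by [(s + t)^2 <= 2 s^2 + 2 t^2]. *)
Lemma absC2_lin (R : realType) (a z w : Cplx R) :
  absC (a * z + w) ^+ 2 <= 2 * (absC a ^+ 2) * absC z ^+ 2 + 2 * absC w ^+ 2.
Proof.
have := absCD (a * z) w; rewrite absCM.
have := absC_ge0 (a * z + w); have := absC_ge0 a; have := absC_ge0 z; have := absC_ge0 w.
move: (absC (a * z + w)) (absC a) (absC z) (absC w) => s t u v v0 u0 t0 s0 st.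
have st2 : s ^+ 2 <= (t * u + v) ^+ 2 by rewrite lerXn2r ?nnegrE ?addr_ge0 ?mulr_ge0.
have := sqr_ge0 (t * u - v); nra.
Qed.

(** * Linear combinations in the square-integrable spaces *)

Section L2Linear.
Variable R : realType.
Implicit Types (D : set (measurableTypeR R)) (f g : R -> Cplx R) (y z : int -> Cplx R * Cplx R).
Local Notation mu := (@lebesgue_measure R).

Lemma measurable_absC2 D f : cmeasurable D f ->
  measurable_fun D (fun x => absC (f x) ^+ 2).
Proof.
case=> mr mi; under eq_fun do rewrite absC2 !expr2.
by apply: measurable_funD; apply: measurable_funM.
Qed.

Lemma cmeasurable_lin D (a : Cplx R) f g : cmeasurable D f -> cmeasurable D g ->
  cmeasurable D (a *: f + g).
Proof.
case: a => a b [fr fi] [gr gi]; split.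
- rewrite (_ : (fun x => _) = (fun x => (a * ReC (f x) - b * ImC (f x)) + ReC (g x))).
    apply: measurable_funD => //; apply: measurable_funB; apply: measurable_funM => //;
      exact: measurable_cst.
  apply/funext => x; rewrite /= -[(_ *: f + g) x]/((a +i* b)%C * f x + g x).
  by case: (f x) (g x) => ? ? [].
- rewrite (_ : (fun x => _) = (fun x => (a * ImC (f x) + b * ReC (f x)) + ImC (g x))).
    apply: measurable_funD => //; apply: measurable_funD; apply: measurable_funM => //;
      exact: measurable_cst.
  apply/funext => x; rewrite /= -[(_ *: f + g) x]/((a +i* b)%C * f x + g x).
  by case: (f x) (g x) => ? ? [].
Qed.

Lemma L2_lin D (a : Cplx R) f g : measurable D -> L2 D f -> L2 D g -> L2 D (a *: f + g).
Proof.
move=> mD [mf f2] [mg g2]; split; first exact: cmeasurable_lin.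
have mf2 := measurable_absC2 mf; have mg2 := measurable_absC2 mg.
have c0 : 0 <= 2 * absC a ^+ 2 by rewrite mulr_ge0 // sqr_ge0.
pose G x := ((2 * absC a ^+ 2)%:E * (absC (f x) ^+ 2)%:E + 2%:E * (absC (g x) ^+ 2)%:E)%E.
apply: (@le_lt_trans _ _ (\int[mu]_(x in D) G x)%E).
  apply: ge0_le_integral => //.
  - by move=> x _; rewrite lee_fin sqr_ge0.
  - apply/measurable_EFinP; apply: measurable_absC2; exact: cmeasurable_lin.
  - by apply: emeasurable_funD; apply: emeasurable_funM => //;
      try exact/measurable_EFinP; exact: measurable_cst.
  - by move=> x _; rewrite /G -!EFinM -EFinD lee_fin; exact: absC2_lin.
rewrite /G ge0_integralD //; last 4 first.
- by move=> x _; rewrite -EFinM lee_fin mulr_ge0 // sqr_ge0.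
- by apply: emeasurable_funM => //; try exact/measurable_EFinP; exact: measurable_cst.
- by move=> x _; rewrite -EFinM lee_fin mulr_ge0 // sqr_ge0.
- by apply: emeasurable_funM => //; try exact/measurable_EFinP; exact: measurable_cst.
rewrite !ge0_integralZl //; try by [exact/measurable_EFinP | move=> x _; rewrite lee_fin sqr_ge0].
by apply: lte_add_pinfty; apply: lte_mul_pinfty.
Qed.

(** With a natural factor, additivity of the sum and induction are enough. *)
Lemma esum_natmul_lty (w : int -> R) (N : nat) : (forall n, 0 <= w n) ->
  (\esum_(n in [set: int]) (w n)%:E < +oo)%E ->
  (\esum_(n in [set: int]) (N%:R * w n)%:E < +oo)%E.
Proof.
move=> w0 wy; elim: N => [|N IH].
  by rewrite esum1 // => n _; rewrite mul0r.
rewrite (eq_esum (b := fun n => ((N%:R * w n)%:E + (w n)%:E)%E)).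
  rewrite esumD; first exact: lte_add_pinfty.
  - by move=> n _; rewrite lee_fin mulr_ge0.
  - by move=> n _; rewrite lee_fin.
by move=> n _; rewrite -EFinD -natr1 mulrDl mul1r.
Qed.

Lemma Lq2_lin (q : R) (a : Cplx R) y z : 0 < q -> q < 1 -> Lq2 q y -> Lq2 q z -> Lq2 q (a *: y + z).
Proof.
move=> q0 q1 y2 z2.
pose W (y : int -> Cplx R * Cplx R) n := (1 - q) * q ^ n * (absC (y n).1 ^+ 2 + absC (y n).2 ^+ 2).
have c0 n : 0 <= (1 - q) * q ^ n by rewrite mulr_ge0 ?subr_ge0 ?(ltW q1) // exprz_ge0 // ltW.
have W0 y' n : 0 <= W y' n by rewrite mulr_ge0 // addr_ge0 // sqr_ge0.
(* The real factor is rounded up to a natural number, to fit [esum_natmul_lty]. *)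
pose N := (Num.bound (2 * absC a ^+ 2)).
have hN : 2 * absC a ^+ 2 <= N%:R by rewrite ltW // archi_boundP // mulr_ge0 // sqr_ge0.
apply: (@le_lt_trans _ _ (\esum_(n in [set: int])
  ((N%:R * W y n)%:E + (2%:R * W z n)%:E))%E); last first.
  rewrite esumD; try by move=> n _; rewrite lee_fin mulr_ge0.
  by apply: lte_add_pinfty; apply: esum_natmul_lty.
apply: le_esum => n _; rewrite -EFinD lee_fin.
have e1 := absC2_lin a (y n).1 (z n).1; have e2 := absC2_lin a (y n).2 (z n).2.
rewrite !(mulrCA _%:R) -mulrDr; apply: ler_wpM2l => //.
have := sqr_ge0 (absC (y n).1); have := sqr_ge0 (absC (y n).2).
rewrite -[((a *: y + z) n).1]/(a * (y n).1 + (z n).1).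
rewrite -[((a *: y + z) n).2]/(a * (y n).2 + (z n).2).
move: e1 e2 hN; move: (absC (_ + _) ^+ 2) (absC (_ + _) ^+ 2).
move: (absC a ^+ 2) (absC _ ^+ 2) (absC _ ^+ 2) (absC _ ^+ 2) (absC _ ^+ 2) (N%:R) => *; nra.
Qed.

Lemma measurable_Rminus : measurable (@Rminus R : set (measurableTypeR R)).
Proof.
have -> : @Rminus R = `]-oo, 0%R]%classic by apply/seteqP; split => x; rewrite /= in_itv.
exact: measurable_itv.
Qed.
Lemma measurable_Rplus : measurable (@Rplus R : set (measurableTypeR R)).
Proof.
have -> : @Rplus R = `[0%R, +oo[%classic by apply/seteqP; split => x; rewrite /= in_itv /= andbT.
exact: measurable_itv.
Qed.

Lemma inH_lin (q : R) (a : Cplx R) (f g : Hsp R) : 0 < q -> q < 1 ->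
  inH q f -> inH q g -> inH q (a *: f + g).
Proof.
move=> q0 q1 [f1 f2 f3] [g1 g2 g3]; split.
- exact: (L2_lin a measurable_Rminus f1 g1).
- exact: Lq2_lin.
- exact: (L2_lin a measurable_Rplus f3 g3).
Qed.

End L2Linear.

Lemma lebesgue_ae_filter (R : realType) : Filter (nbhs (almost_everywhere (@lebesgue_measure R))).
Proof. exact: (@ae_filter_ringOfSetsType _ _ _ (@lebesgue_measure R)). Qed.

Lemma ae_imply2 (R : realType) (P Q S : R -> Prop) : (forall x, P x -> Q x -> S x) ->
  {ae (@lebesgue_measure R), forall x, P x} -> {ae (@lebesgue_measure R), forall x, Q x} ->
  {ae (@lebesgue_measure R), forall x, S x}.
Proof. by move=> h; apply: (filterS2 (lebesgue_ae_filter R)). Qed.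

Lemma ae_imply3 (R : realType) (P Q S W : R -> Prop) : (forall x, P x -> Q x -> S x -> W x) ->
  {ae (@lebesgue_measure R), forall x, P x} -> {ae (@lebesgue_measure R), forall x, Q x} ->
  {ae (@lebesgue_measure R), forall x, S x} -> {ae (@lebesgue_measure R), forall x, W x}.
Proof. by move=> h; apply: (filterS3 (lebesgue_ae_filter R)). Qed.

(** * The closed subspace of vectors with F_+ f = T F_- f *)

Section Coincidence.
Variables (R : realType) (q : R) (T : R -> Cplx R) (Fm Fp : Hsp R -> R -> Cplx R).
Hypotheses (q0 : 0 < q) (q1 : q < 1) (T1 : forall l, absC (T l) = 1).
Local Notation mu := (@lebesgue_measure R).

(** The clauses of [spectral_representation] by which an identity between two representations passes
    to linear combinations and limits. *)
Definition isometric_into_L2 (F : Hsp R -> R -> Cplx R) :=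
  [/\ forall f, inH q f -> L2 setT (F f),
      forall f g, inH q f -> inH q g -> eqH f g -> ae_eq_on setT (F f) (F g),
      forall (a : Cplx R) f g, inH q f -> inH q g ->
        ae_eq_on setT (F (a *: f + g)) (a *: F f + F g)
    & forall f, inH q f -> L2norm2 setT (F f) = Hnorm2 q f].

Hypotheses (Fm_iso : isometric_into_L2 Fm) (Fp_iso : isometric_into_L2 Fp).

Definition coincide (f : Hsp R) :=
  inH q f /\ ae_eq_on setT (Fp f) (fun l => T l * Fm f l).

Lemma coincide_eqH f g : inH q g -> eqH f g -> coincide f -> coincide g.
Proof.
move=> gH fg [fH c]; split => //.
have [_ em _ _] := Fm_iso; have [_ ep _ _] := Fp_iso.
have h1 := em _ _ fH gH fg; have h2 := ep _ _ fH gH fg.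
rewrite /ae_eq_on in h1 h2 c *.
by apply: ae_imply3 h1 h2 c => x /(_ I) e1 /(_ I) e2 /(_ I) e3 _; rewrite -e2 e3 e1.
Qed.

Lemma coincide_lin (a : Cplx R) f g : coincide f -> coincide g -> coincide (a *: f + g).
Proof.
move=> [fH cf] [gH cg]; split; first exact: inH_lin.
have [_ _ lm _] := Fm_iso; have [_ _ lp _] := Fp_iso.
have h1 := lm a _ _ fH gH; have h2 := lp a _ _ fH gH.
rewrite /ae_eq_on in h1 h2 cf cg *.
have h3 := @filterI _ _ (lebesgue_ae_filter R) _ _ h1 h2.
apply: ae_imply3 h3 cf cg => x [/(_ I) e1 /(_ I) e2] /(_ I) e3 /(_ I) e4 _.
rewrite e1 e2 -[LHS]/(a * Fp f x + Fp g x) -[X in T x * X]/(a * Fm f x + Fm g x) e3 e4.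
by ring.
Qed.

(* [T] need not be measurable: [|Fp f - T Fm f|^2] is only compared with the
   infimum of the measurable functions [G n], whose integrals tend to [0]. *)
Lemma coincide_closed f (u : nat -> Hsp R) : inH q f -> (forall n, coincide (u n)) ->
  Hnorm2 q (-1 *: u n + f) @[n --> \oo] --> 0%E -> coincide f.
Proof.
move=> fH uc uf; split => //.
have [L2m em lm im] := Fm_iso; have [L2p ep lp ip] := Fp_iso.
pose d n := -1 *: u n + f.
have dH n : inH q (d n) by apply: inH_lin => //; exact: (uc n).1.
pose G n x := (2%:E * (absC (Fp (d n) x) ^+ 2)%:E + 2%:E * (absC (Fm (d n) x) ^+ 2)%:E)%E.
have mp n : measurable_fun setT (fun x => (absC (Fp (d n) x) ^+ 2)%:E).
  by apply/measurable_EFinP; apply: measurable_absC2; exact: (L2p _ (dH n)).1.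
have mm n : measurable_fun setT (fun x => (absC (Fm (d n) x) ^+ 2)%:E).
  by apply/measurable_EFinP; apply: measurable_absC2; exact: (L2m _ (dH n)).1.
have mG n : measurable_fun setT (G n).
  by apply: emeasurable_funD; apply: emeasurable_funM => //;
    first [exact: mp|exact: mm|exact: measurable_cst].
have G0 n x : (0 <= G n x)%E.
  by rewrite /G -!EFinM -EFinD lee_fin addr_ge0 // mulr_ge0 // sqr_ge0.
have iG n : (\int[mu]_(x in setT) G n x = 4%:E * Hnorm2 q (d n))%E.
  rewrite /G ge0_integralD //=; last 4 first.
  - by move=> x _; rewrite -EFinM lee_fin mulr_ge0 // sqr_ge0.
  - by apply: emeasurable_funM => //; first [exact: mp|exact: mm|exact: measurable_cst].
  - by move=> x _; rewrite -EFinM lee_fin mulr_ge0 // sqr_ge0.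
  - by apply: emeasurable_funM => //; first [exact: mp|exact: mm|exact: measurable_cst].
  rewrite !ge0_integralZl //; try by move=> x _; rewrite lee_fin sqr_ge0.
  - rewrite -![integral _ _ _]/(L2norm2 setT _) ip // im // -ge0_muleDl ?lee_fin //.
    by rewrite -EFinD; congr (_%:E * _)%E; ring.
  - exact: mm.
  - exact: mp.
(* Started at index 0, [einfs] is the infimum of the whole sequence: it is measurable and lies below
   every [G n], so its integral is 0. *)
pose K x := einfs (fun n => G n x) 0.
have mK : measurable_fun setT K by apply: measurable_fun_einfs.
have K0 x : (0 <= K x)%E.
  by apply: le_ereal_inf_tmp => _ [k _ <-].
have KG k x : (K x <= G k x)%E by apply: ereal_inf_lbound; exists k.
have iK0 : (\int[mu]_(x in setT) K x = 0)%E.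
  apply/eqP; rewrite eq_le integral_ge0 // andbT.
  have lim0 : (4%:E * Hnorm2 q (d n))%E @[n --> \oo] --> (4%:E * 0)%E by apply: cvgeZl.
  rewrite mule0 in lim0; rewrite -(cvg_lim _ lim0) //; apply: lime_ge.
    by apply/cvg_ex; exists 0%E.
  apply: nearW => n; rewrite -iG; apply: ge0_le_integral => //.
  - exact: mG.
have K_ae : {ae mu, forall x, setT x -> K x = 0%E}.
  apply/(ae_eq_integral_abs mu measurableT mK).
  by rewrite -[RHS]iK0; apply: eq_integral => x _; rewrite gee0_abs.
(* Countably many relations, one family for each [n], hold together off a single null set. *)
have lin_ae : {ae mu, forall x n, Fp (d n) x = - Fp (u n) x + Fp f x /\
    Fm (d n) x = - Fm (u n) x + Fm f x /\ Fp (u n) x = T x * Fm (u n) x}.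
  apply: ae_foralln => n.
  have h1 := lm (-1) _ _ (uc n).1 fH; have h2 := lp (-1) _ _ (uc n).1 fH.
  have h3 := (uc n).2.
  rewrite /ae_eq_on in h1 h2 h3 *.
  apply: ae_imply3 h1 h2 h3 => x /(_ I) e1 /(_ I) e2 /(_ I) e3.
  rewrite e1 e2 -[LHS]/(-1 * Fp (u n) x + Fp f x).
  by rewrite -[X in _ /\ X = _ /\ _]/(-1 * Fm (u n) x + Fm f x) !mulN1r.
rewrite /ae_eq_on; apply: ae_imply2 K_ae lin_ae => x /(_ I) Kx lx _.
have wG n : ((absC (- Fp f x + T x * Fm f x) ^+ 2)%:E <= G n x)%E.
  have [e1 [e2 e3]] := lx n; rewrite /G -!EFinM -EFinD lee_fin.
  (* The coincidence of [u n] cancels its contribution, so the defect of [f] at [x] is that of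
     [d n]. *)
  have -> : - Fp f x + T x * Fm f x = (-1) * Fp (d n) x + T x * Fm (d n) x.
    by rewrite e1 e2 e3; ring.
  have := absC2_lin (-1) (Fp (d n) x) (T x * Fm (d n) x).
  by rewrite absCN absCM T1 mul1r (_ : absC 1 = 1) ?expr1n ?mulr1 // absC_toC normr1.
have : ((absC (- Fp f x + T x * Fm f x) ^+ 2)%:E <= 0)%E.
  by rewrite -Kx; apply: le_ereal_inf_tmp => _ [k _ <-].
rewrite lee_fin => w0; have w00 : absC (- Fp f x + T x * Fm f x) = 0.
  by apply/eqP; rewrite -sqrf_eq0 eq_le w0 sqr_ge0.
by move/absC_eq0/eqP: w00; rewrite addrC subr_eq0 => /eqP.
Qed.

End Coincidence.

(** * Smooth bump functions *)

Section Smooth.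
Variable R : realType.
Implicit Types (f g : R -> R) (Q : {poly R}).

(* [diff_times k f]: [f] is [k.+1] times differentiable. *)
Fixpoint diff_times (k : nat) f : Prop :=
  exists2 f' : R -> R, (forall x : R, is_derive x (1 : R) f (f' x)) &
    if k is k'.+1 then diff_times k' f' else True.

Lemma diff_times_derivable k f : diff_times k f -> forall x, derivable (derive1n k f) x 1.
Proof.
elim: k f => [|k IH] f [f' ff' h] x.
  by have [d _] := ff' x.
rewrite derive1Sn (_ : derive1 f = f'); first exact: IH.
by apply/funext => t; rewrite derive1E; have [_ ->] := ff' t.
Qed.

Lemma diff_timesW k f : diff_times k.+1 f -> diff_times k f.
Proof.
elim: k f => [|k IH] f [f' ff' h]; exists f' => //; exact: IH.
Qed.

Lemma diff_timesD k f g : diff_times k f -> diff_times k g -> diff_times k (fun x => f x + g x).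
Proof.
elim: k f g => [|k IH] f g [f' ff' hf] [g' gg' hg].
  by exists (fun x => f' x + g' x) => // x; exact: is_deriveD.
by exists (fun x => f' x + g' x); [move=> x; exact: is_deriveD | exact: IH].
Qed.

Lemma diff_timesM k f g : diff_times k f -> diff_times k g -> diff_times k (fun x => f x * g x).
Proof.
elim: k f g => [|k IH] f g hf hg; have := hf; have := hg => -[g' gg' h1] [f' ff' h2].
  by exists (fun x => f x * g' x + g x * f' x) => // x; exact: is_deriveM.
exists (fun x => f x * g' x + g x * f' x); first by move=> x; exact: is_deriveM.
by apply: diff_timesD; apply: IH => //; exact: diff_timesW.
Qed.

Lemma diff_times_cst k c : diff_times k (fun _ => c).
Proof.
elim: k c => [|k IH] c; exists (fun _ => 0) => // x; exact: is_derive_cst.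
Qed.

Lemma diff_times_affine k f (c d : R) : diff_times k f -> diff_times k (fun x => f (c * x + d)).
Proof.
have aff (x : R) : is_derive x (1 : R) (fun x => c * x + d) c.
  have := is_deriveD (is_deriveZ c (is_derive_id x (1 : R))) (is_derive_cst d x (1 : R)).
  by rewrite addr0 -[_ *: _]/(c * 1) mulr1.
elim: k f => [|k IH] f [f' ff' h].
  by exists (fun x => f' (c * x + d) * c) => // x; apply: (is_derive1_comp (ff' _)).
exists (fun x => f' (c * x + d) * c); first by move=> x; apply: (is_derive1_comp (ff' _)).
by apply: diff_timesM; [exact: IH | exact: diff_times_cst].
Qed.

(** With an arbitrary polynomial [Q] in [1/x] as a factor of [exp(-1/x)], the family is closed under
    differentiation. *)
Definition flat Q (x : R) : R := if 0 < x then Q.[x^-1] * expR (- x^-1) else 0.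

(* [t ^+ i <= i! * expR t] for [t = x^-1 >= 0]. *)
Lemma flat_bounded Q : exists2 C : R, 0 <= C & forall x, `|flat Q x| <= C.
Proof.
exists (\sum_(i < size Q) `|Q`_i| * i`!%:R).
  by apply: sumr_ge0 => i _; rewrite mulr_ge0.
move=> x; rewrite /flat; case: ifP => [x0|_]; last first.
  by rewrite normr0; apply: sumr_ge0 => i _; rewrite mulr_ge0.
have t0 : 0 <= x^-1 by rewrite invr_ge0 ltW.
rewrite horner_coef mulr_suml (le_trans (ler_norm_sum _ _ _)) //.
apply: ler_sum => i _; rewrite -mulrA normrM ler_wpM2l // ger0_norm; last first.
  by rewrite mulr_ge0 ?exprn_ge0 ?expR_ge0.
rewrite expRN ler_pdivrMr ?expR_gt0 //.
case: i => -[|i] _ /=.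
  by rewrite expr0 fact0 mul1r (le_trans _ (expR_ge1Dx _)) // lerDl.
have := expR_ge1Dxn i t0; have f0 : 0 < i.+1`!%:R :> R by rewrite ltr0n fact_gt0.
move=> e; rewrite mulrC -ler_pdivrMr //; apply: le_trans e; by rewrite lerDr.
Qed.

(** Exhibits [flat Q] as [x^2] times a bounded function, for the derivative at 0. *)
Lemma flat_scale Q x : flat Q x = x ^+ 2 * flat ('X^2 * Q) x.
Proof.
rewrite /flat; case: ifP => [x0|]; last by rewrite mulr0.
rewrite hornerM hornerXn; move: Q.[x^-1] (expR _) => a b.
have -> : x ^+ 2 * (x^-1 ^+ 2 * a * b) = (x * x^-1) ^+ 2 * (a * b) by ring.
by rewrite mulfV ?gt_eqF // expr1n mul1r.
Qed.

(** For positive [x], the chain rule applied to [Q(1/x) exp(-1/x)] gives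
    [x^-2 (Q - Q')(1/x) exp(-1/x)]. To the left of 0 the function is constant. *)
Lemma is_derive_flat Q (x : R) : is_derive x (1 : R) (flat Q) (flat ('X^2 * (Q - Q^`())) x).
Proof.
have [x0|x0|->] := ltgtP x 0.
- apply: (@near_eq_is_derive _ _ _ (fun=> 0)); last first.
    by rewrite /flat ltNge (ltW x0) /=; exact: is_derive_cst.
  near=> y; have y0 : y < 0 by near: y; exact: lt_nbhsl.
  by rewrite /flat ltNge (ltW y0).
- apply: (@near_eq_is_derive _ _ _
    (fun y => (horner Q \o GRing.inv) y * (expR \o (fun y => - y^-1)) y)).
    near=> y; have y0 : 0 < y by near: y; exact: lt_nbhsr.
    by rewrite /flat y0.
  have dV : is_derive x (1 : R) (fun y : R => y^-1) (- x ^- 2 *: 1).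
    by apply: is_deriveV; rewrite ?gt_eqF.
  have d1 : is_derive x (1 : R) (horner Q \o GRing.inv) (Q^`().[x^-1] * (- x ^- 2 *: 1)).
    by apply: is_derive1_comp => //; exact: is_derive_poly.
  have d2 : is_derive x (1 : R) (expR \o (fun y : R => - y^-1)) (expR (- x^-1) * - (- x ^- 2 *: 1)).
    by apply: is_derive1_comp.
  have := is_deriveM d1 d2; congr is_derive.
  rewrite /flat x0 hornerM hornerXn hornerD hornerN -exprVn /=.
  by rewrite -![_ *: _]/(_ * _); ring.
- rewrite {2}/flat ltxx.
  have [C C0 hC] := flat_bounded ('X^2 * Q).
  have F0 : flat Q 0 = 0 by rewrite /flat ltxx.
  have lim0 : (h^-1 *: ((flat Q \o shift 0) (h *: (1 : R)) - flat Q 0))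
      @[h --> (0 : R)^'] --> (0 : R).
    (* By [flat_scale] the difference quotient at [h] is [h] times a value bounded by [C]. *)
    apply: (@cvg_to_0_linear _ _ C 1) => // h /andP[h0 _].
    rewrite F0 subr0 /= addr0 -[h *: 1]/(h * 1) mulr1 -[_ *: _]/(_ * _).
    have hn : h != 0 by rewrite -normr_gt0.
    rewrite flat_scale; have := hC h; move: (flat ('X^2 * Q) h) => w hw.
    by rewrite expr2 -!mulrA mulKf // normrM mulrC ler_wpM2r.
  by split; [apply/cvg_ex; exists 0 | exact: cvg_lim lim0].
Unshelve. all: end_near.
Qed.

Lemma diff_times_flat k Q : diff_times k (flat Q).
Proof.
elim: k Q => [|k IH] Q; exists (flat ('X^2 * (Q - Q^`()))) => //; exact: is_derive_flat.
Qed.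

(* [exp (-1/((n+1)(x-a))) exp (-1/((n+1)(b-x)))] on [`]a, b[], and [0] elsewhere. *)
Definition smooth_bump (a b : R) (n : nat) (x : R) : R :=
  flat 1 (n.+1%:R * (x - a)) * flat 1 (n.+1%:R * (b - x)).

Lemma smooth_compact_bump a b n : smooth_compact (fun x => toC (smooth_bump a b n x)).
Proof.
split.
- move=> k x; split.
    have -> : (fun t => ReC (toC (smooth_bump a b n t))) = (fun t =>
        flat 1 (n.+1%:R * t + - (n.+1%:R * a)) * flat 1 (- n.+1%:R * t + n.+1%:R * b)).
      by apply/funext => t; rewrite /smooth_bump; congr (flat _ _ * flat _ _); ring.
    apply: diff_times_derivable; apply: diff_timesM; apply: diff_times_affine;
      exact: diff_times_flat.
  by apply: diff_times_derivable; exact: diff_times_cst.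
- exists (`|a| + `|b|) => x xM; rewrite /smooth_bump /flat !pmulr_rgt0 // !subr_gt0.
  case: ifP => ax; last by rewrite mul0r.
  case: ifP => xb; last by rewrite mulr0.
  have := ler_norm b; have := ler_norm (- a); rewrite normrN => h1 h2.
  have := normr_ge0 a; have := normr_ge0 b.
  move=> b0 a0; exfalso; move: xM; apply/negP; rewrite -leNgt ler_norml.
  by apply/andP; split; lra.
Qed.

Lemma bump_bounded a b n x : `|smooth_bump a b n x| <= \1_(`]a, b[) x.
Proof.
rewrite indicE /smooth_bump /flat !pmulr_rgt0 // !subr_gt0.
rewrite (_ : (x \in _) = (a < x) && (x < b)); last by rewrite mem_setE in_itv.
case: ifP => ax; last by rewrite mul0r normr0.
case: ifP => xb; last by rewrite mulr0 normr0.
rewrite /= !hornerC !mul1r ger0_norm ?mulr_ge0 ?expR_ge0 //.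
rewrite mulr_ile1 ?expR_ge0 // -expR0 ler_expR oppr_le0 invr_ge0 mulr_ge0 // subr_ge0 ltW //.
Qed.

(** Inside the interval both exponents, such as [-1/((n+1)(x-a))], tend to 0; outside, one factor is
    0 for every [n]. *)
Lemma cvg_bump a b x : smooth_bump a b n x @[n --> \oo] --> (\1_(`]a, b[) x : R).
Proof.
have fc (c : R) : 0 < c -> expR (- (n.+1%:R * c)^-1) @[n --> \oo] --> (1 : R).
  move=> c0; have h0 : harmonic n * c^-1 @[n --> \oo] --> (0 : R) * c^-1.
    by apply: cvgMl; exact: cvg_harmonic.
  have h1 : - (harmonic n * c^-1) @[n --> \oo] --> - (0 * c^-1 : R) by exact: cvgN.
  rewrite mul0r oppr0 in h1.
  rewrite -[X in _ --> X]expR0; under eq_fun do rewrite invfM.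
  exact: (cvg_comp _ _ h1 (@continuous_expR R 0)).
rewrite indicE (_ : (x \in _) = (a < x) && (x < b)); last by rewrite mem_setE in_itv.
have E n : smooth_bump a b n x = (if a < x then expR (- (n.+1%:R * (x - a))^-1) else 0)
    * (if x < b then expR (- (n.+1%:R * (b - x))^-1) else 0).
  by rewrite /smooth_bump /flat !pmulr_rgt0 // !subr_gt0 !hornerC !mul1r.
under eq_fun do rewrite E.
case: (ltP a x) => ax; last by under eq_fun do rewrite mul0r; exact: cvg_cst.
case: (ltP x b) => xb; last by under eq_fun do rewrite mulr0; exact: cvg_cst.
have h : expR (- (n.+1%:R * (x - a))^-1) * expR (- (n.+1%:R * (b - x))^-1)
    @[n --> \oo] --> (1 * 1 : R) by apply: cvgM; apply: fc; rewrite subr_gt0.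
by rewrite mul1r in h.
Qed.

End Smooth.

(** * Density in L^2 *)

Section Density.
Variables (R : realType) (D : set (measurableTypeR R)) (P : (R -> R) -> Prop).
Local Notation mu := (@lebesgue_measure R).
Hypothesis mD : measurable D.
Hypothesis P_lin : forall a u v, P u -> P v -> P (fun x => a * u x + v x).
(** Closure under dominated pointwise convergence, with a majorant square integrable on [D];
    dominated convergence will reduce it to closedness in norm. *)
Hypothesis P_lim : forall (u_ : nat -> R -> R) (u g : R -> R),
  (forall n, P (u_ n)) ->
  measurable_fun setT (u : measurableTypeR R -> R) ->
  measurable_fun setT (g : measurableTypeR R -> R) ->
  (\int[mu]_(x in D) (g x ^+ 2)%:E < +oo)%E ->
  (forall n x, `|u_ n x| <= g x) -> (forall x, u_ n x @[n --> \oo] --> u x) -> P u.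
Hypothesis P_bump : forall a b n, P (smooth_bump a b n).

Lemma density_zero : P (fun=> 0).
Proof.
have := P_lin (-1) (P_bump 0 0 0) (P_bump 0 0 0); congr P.
by apply/funext => x; rewrite mulN1r addNr.
Qed.

Lemma indic_itv_L2 (a b : R) : (\int[mu]_(x in D) ((\1_(`]a, b[) x : R) ^+ 2)%:E < +oo)%E.
Proof.
have -> : (fun x : measurableTypeR R => ((\1_(`]a, b[) x : R) ^+ 2)%:E) =
    (fun x => (\1_(`]a, b[ : set (measurableTypeR R)) x)%:E).
  by apply/funext => x; rewrite indicE; case: (x \in _); rewrite ?expr1n ?expr0n.
rewrite integral_indic //.
apply: (@le_lt_trans _ _ (mu `]a, b[)).
  by apply: le_measure; rewrite ?inE //; apply: measurableI.
by rewrite lebesgue_measure_itv /=; case: ifP => // _; rewrite -EFinB ltry.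
Qed.

Lemma density_itv (a b : R) : P \1_(`]a, b[).
Proof.
apply: (@P_lim (smooth_bump a b) _ \1_(`]a, b[)).
- exact: P_bump.
- exact: measurable_indic.
- exact: measurable_indic.
- exact: indic_itv_L2.
- exact: bump_bounded.
- exact: cvg_bump.
Qed.

(** Dynkin induction from the rays []x, +oo[], which are stable under intersection. Cutting with
    []-N, N[] supplies a square-integrable majorant at every stage. *)
Lemma density_bounded_set (N : R) (A : set (measurableTypeR R)) : measurable A ->
  P \1_(A `&` `]-N, N[).
Proof.
have G := @RGenOInfty.measurableE R.
move=> mA; have : <<s @RGenOInfty.G R >> A by rewrite -[<<s _ >>]G.
move: A {mA}; apply: (dynkin_induction (T := measurableTypeR R) (G := @RGenOInfty.G R)
  (P := fun A => P \1_(A `&` `]-N, N[))) => //.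
- move=> _ _ [x ->] [y ->]; exists (Num.max x y).
  by apply/seteqP; split => z /=; rewrite !in_itv /= !andbT gt_max => /andP.
- by rewrite setTI; exact: density_itv.
- move=> _ [x ->]; rewrite (_ : _ `&` _ = `]Num.max x (- N), N[%classic); first exact: density_itv.
  apply/seteqP; split => z /=; rewrite !in_itv /= !andbT gt_max.
    by move=> [-> /andP[-> ->]].
  by move=> /andP[/andP[-> ->] ->].
(* The complement of [S] within []-N, N[] has as indicator the difference of two indicators already
   reached. *)
- move=> S mS PS.
  have := P_lin (-1) PS (density_itv (- N) N); congr P; apply/funext => x.
  rewrite !indicE !in_setI in_setC.
  by case: (x \in S); case: (x \in _); rewrite /= ?mulr0 ?mulr1 ?add0r ?addNr.
- move=> F mF tF PF.
  (* By disjointness the indicators of the partial unions are sums; they converge pointwise to that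
     of the full union. *)
  pose B n := \bigcup_(k < n) F k.
  have PB n : P \1_(B n `&` `]-N, N[).
    elim: n => [|n IH].
      rewrite (_ : \1__ = fun=> 0); first exact: density_zero.
      by apply/funext => x; rewrite indicE memNset // => -[[k]].
    have := P_lin 1 IH (PF n); congr P; apply/funext => x.
    rewrite mul1r !indicE -natrD; congr (_%:R).
    rewrite !in_setI; case: (x \in `]-N, N[%classic) => /=; last by rewrite !andbF.
    rewrite !andbT.
    have -> : (x \in B n.+1) = (x \in B n) || (x \in F n).
      apply/idP/idP.
        rewrite inE => -[k /= kn Fx]; move: kn; rewrite ltnS leq_eqVlt => /orP[/eqP <-|kn].
          by rewrite (mem_set Fx) orbT.
        by rewrite (_ : x \in B n) // inE; exists k.
      move=> /orP[]; rewrite !inE; last by move=> Fx; exists n => /=.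
      by move=> [k /= kn Fx]; exists k => //=; rewrite ltnW.
    case: (boolP (x \in B n)); case: (boolP (x \in F n)) => // xF xB; exfalso.
    move: xF xB; rewrite !inE => Fn [k /= kn Fk].
    have e : k = n by apply: (tF k n I I); exists x.
    by move: kn; rewrite e /= ltnn.
  apply: (@P_lim (fun n => \1_(B n `&` `]-N, N[)) _ \1_(`]-N, N[)) => //.
  + by apply: measurable_indic; apply: measurableI => //; exact: bigcup_measurable.
  + exact: indic_itv_L2.
  + move=> n x; rewrite !indicE in_setI; case: (x \in B n); case: (x \in _) => /=;
      by rewrite ?normr0 ?normr1.
  + move=> x; apply: cvg_near_cst.
    rewrite indicE in_setI.
    have [|xF] := boolP (x \in \bigcup_k F k).
      rewrite inE => -[k _ Fk]; exists k.+1 => // n /= kn.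
      by rewrite indicE in_setI (_ : x \in B n) // inE; exists k.
    apply: nearW => n; rewrite indicE in_setI [x \in B n]memNset // => -[k _ Fk].
    by move: xF; rewrite notin_setE => h; apply: h; exists k.
Qed.

Import HBNNSimple.

(** Simple functions increasing to [u] are cut to []-n, n[], which makes their level sets bounded;
    [u] itself is the majorant. *)
Lemma density_nonneg (u : R -> R) : measurable_fun setT (u : measurableTypeR R -> R) ->
  (forall x, 0 <= u x) -> (\int[mu]_(x in D) (u x ^+ 2)%:E < +oo)%E -> P u.
Proof.
move=> mu_ u0 u2.
have mf : measurable_fun setT (EFin \o (u : measurableTypeR R -> R)) by apply/measurable_EFinP.
have [s [s_nd s_cvg]] := approximation measurableT mf (fun x _ => u0 x).
have s_cvg' x : s n x @[n --> \oo] --> u x.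
  exact: (fine_cvg (s_cvg x I)).
have s_le n x : s n x <= u x.
  rewrite -(cvg_lim (@Rhausdorff R) (s_cvg' x)); apply: nondecreasing_cvgn_le.
    by move=> i j ij; have /lefP := s_nd _ _ ij; apply.
  by apply/cvg_ex; exists (u x).
pose I_ (n : nat) : set (measurableTypeR R) := `]- n%:R, n%:R[%classic.
apply: (@P_lim (fun n x => s n x * \1_(I_ n) x) u u) => //.
- move=> n.
  have -> : (fun x => s n x * \1_(I_ n) x) =
    (fun x => \sum_(y <- fset_set (range (s n))) y * \1_((s n) @^-1` [set y] `&` I_ n) x).
    apply/funext => x; rewrite fimfunE fsbig_finite // mulr_suml; apply: eq_bigr => y _.
    by rewrite -mulrA !indicE in_setI -natrM mulnb.
  elim: (enum_fset _) => [|y l IH].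
    have := density_zero; congr P; apply/funext => x; by rewrite big_nil.
  have h : P \1_((s n) @^-1` [set y] `&` I_ n).
    apply: density_bounded_set; rewrite -[X in measurable X]setTI.
    exact: measurable_funP.
  have := P_lin y h IH; congr P; apply/funext => x; by rewrite big_cons.
- move=> n x; rewrite ger0_norm ?mulr_ge0 // indicE.
  by case: (x \in _); rewrite ?mulr1 ?mulr0.
- move=> x; rewrite -[X in _ --> X]mulr1; apply: cvgM; first exact: s_cvg'.
  apply: cvg_near_cst; exists (Num.bound `|x|) => // n /= xn.
  rewrite indicE mem_set //; rewrite /I_ /= in_itv /= -ltr_norml.
  by rewrite (lt_le_trans (archi_boundP (normr_ge0 x))) // ler_nat.
Qed.

(** Positive and negative parts are both bounded by the modulus of [u]. *)
Lemma density_L2 (u : R -> R) : measurable_fun setT (u : measurableTypeR R -> R) ->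
  (\int[mu]_(x in D) (u x ^+ 2)%:E < +oo)%E -> P u.
Proof.
move=> mu_ u2.
have part (v : R -> R) : measurable_fun setT (v : measurableTypeR R -> R) ->
    (forall x, 0 <= v x) -> (forall x, v x <= `|u x|) -> P v.
  move=> mv v0 vu; apply: density_nonneg => //; apply: le_lt_trans u2.
  apply: ge0_le_integral => //.
  - by move=> x _; rewrite lee_fin sqr_ge0.
  - by apply/measurable_EFinP; apply: measurable_funX; exact: measurable_funTS.
  - by apply/measurable_EFinP; apply: measurable_funX; exact: measurable_funTS.
  - by move=> x _; rewrite lee_fin -(real_normK (num_real (u x))) lerXn2r // nnegrE.
have Pp : P (fun x => Num.max (u x) 0).
  apply: part.
  - exact: (measurable_funrpos (f := u)).
  - by move=> x; rewrite le_max lexx orbT.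
  - by move=> x; rewrite ge_max normr_ge0 ler_norm.
have Pn : P (fun x => Num.max (- u x) 0).
  apply: part.
  - exact: (measurable_funrneg (f := u)).
  - by move=> x; rewrite le_max lexx orbT.
  - by move=> x; rewrite ge_max normr_ge0 -normrN ler_norm.
have := P_lin (-1) Pn Pp; congr P; apply/funext => x.
case: (boolP (0 <= u x)) => ux.
  by rewrite [X in -1 * X]max_r ?oppr_le0 // mulr0 add0r max_l.
have {}ux : u x <= 0 by rewrite ltW // ltNge.
by rewrite [X in -1 * X]max_l ?oppr_ge0 // mulN1r opprK max_r // addr0.
Qed.

End Density.

(** * Density of the test vectors *)

Section RealL2.
Variables (R : realType) (D : set (measurableTypeR R)).
Local Notation mu := (@lebesgue_measure R).
Hypothesis mD : measurable D.

Lemma L2norm2_toC (u : R -> R) :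
  L2norm2 D (fun x => toC (u x)) = (\int[mu]_(x in D) (u x ^+ 2)%:E)%E.
Proof.
by apply: eq_integral => x _; rewrite absC_toC real_normK // num_real.
Qed.

Lemma L2_toC (u : R -> R) : measurable_fun D (u : measurableTypeR R -> R) ->
  (\int[mu]_(x in D) (u x ^+ 2)%:E < +oo)%E -> L2 D (fun x => toC (u x)).
Proof. by move=> mu_ u2; split; [split => //; exact: measurable_cst | rewrite L2norm2_toC]. Qed.

Lemma L2norm2_0 : L2norm2 D (fun=> 0) = 0%E.
Proof.
by rewrite /L2norm2 integral0_eq // => x _; rewrite absC0 expr0n.
Qed.

(** Since [u] and all [u_ n] are bounded by [g], the squared differences have the integrable
    majorant [4 g^2], and dominated convergence applies to them. *)
Lemma dominated_L2_cvg (u_ : nat -> R -> R) (u g : R -> R) :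
  (forall n, measurable_fun D (u_ n : measurableTypeR R -> R)) ->
  measurable_fun D (u : measurableTypeR R -> R) ->
  measurable_fun D (g : measurableTypeR R -> R) ->
  (\int[mu]_(x in D) (g x ^+ 2)%:E < +oo)%E ->
  (forall n x, `|u_ n x| <= g x) -> (forall x, u_ n x @[n --> \oo] --> u x) ->
  (\int[mu]_(x in D) (u x ^+ 2)%:E < +oo)%E /\
  ((\int[mu]_(x in D) ((u x - u_ n x) ^+ 2)%:E)%E @[n --> \oo] --> 0%E).
Proof.
move=> mu_ mu0 mg g2 ug uu.
have ule x : `|u x| <= g x.
  have h : `|u_ n x| @[n --> \oo] --> `|u x| by exact: cvg_norm.
  rewrite -(cvg_lim (@Rhausdorff R) h); apply: limr_le.
    by apply/cvg_ex; exists `|u x|.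
  by apply: nearW => n; exact: ug.
have g0 x : 0 <= g x by rewrite (le_trans _ (ule x)).
have ig : mu.-integrable D (fun x => (4 * g x ^+ 2)%:E).
  apply/integrableP; split.
    apply/measurable_EFinP; apply: measurable_funM; first exact: measurable_cst.
    exact: measurable_funX.
  under eq_integral => x _ do rewrite gee0_abs ?lee_fin ?mulr_ge0 ?sqr_ge0 // EFinM.
  rewrite ge0_integralZl //; first exact: lte_mul_pinfty.
    by apply/measurable_EFinP; exact: measurable_funX.
  by move=> x _; rewrite lee_fin sqr_ge0.
split.
  apply: le_lt_trans g2; apply: ge0_le_integral => //.
  - by move=> x _; rewrite lee_fin sqr_ge0.
  - by apply/measurable_EFinP; exact: measurable_funX.
  - by apply/measurable_EFinP; exact: measurable_funX.
  - by move=> x _; rewrite lee_fin -(real_normK (num_real (u x))) lerXn2r // nnegrE.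
have m4 n : measurable_fun D (fun x : measurableTypeR R => ((u x - u_ n x) ^+ 2)%:E).
  by apply/measurable_EFinP; apply: measurable_funX; exact: measurable_funB.
have c0 : {ae mu, forall x, D x -> ((u x - u_ n x) ^+ 2)%:E @[n --> \oo] --> 0%E}.
  apply: aeW => x _; apply: cvg_EFin; first by apply: nearW.
  have h1 : u x - u_ n x @[n --> \oo] --> u x - u x.
    by apply: cvgB; [exact: cvg_cst | exact: uu].
  have h2 : (u x - u_ n x) * (u x - u_ n x) @[n --> \oo] --> (u x - u x) * (u x - u x).
    by exact: cvgM.
  rewrite subrr mul0r in h2.
  by apply: cvg_trans h2; apply: near_eq_cvg; apply: nearW => n; rewrite /= expr2.
have b4 : {ae mu, forall x n, D x -> (`|((u x - u_ n x) ^+ 2)%:E| <= (4 * g x ^+ 2)%:E)%E}.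
  apply: aeW => x n _; rewrite gee0_abs ?lee_fin ?sqr_ge0 //.
  have := ug n x; have := ule x; rewrite !ler_norml => /andP[h1 h2] /andP[h3 h4].
  rewrite -(real_normK (num_real (u x - u_ n x))).
  rewrite (_ : 4 * g x ^+ 2 = (2 * g x) ^+ 2); last by ring.
  rewrite lerXn2r ?nnegrE ?mulr_ge0 // ler_norml; apply/andP; split; lra.
have [_ _] := dominated_convergence mD m4 (measurable_cst (0%E : \bar R)) c0 ig b4.
by rewrite integral0.
Qed.

End RealL2.

Lemma smooth_compact_L2 (R : realType) (D : set (measurableTypeR R)) (u : R -> Cplx R) :
  measurable D -> smooth_compact u -> L2 D u.
Proof.
move=> mD us; have [c1 c2] := smooth_compact_continuous us; have [_ [M u0]] := us.
have meas (f : R -> R) : continuous f -> measurable_fun D (f : measurableTypeR R -> R).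
  by move=> fc; apply: measurable_funTS; exact: continuous_measurable_fun.
split; first by split; exact: meas.
rewrite /L2norm2.
have /integrableP[_] : (@lebesgue_measure R).-integrable D (EFin \o (fun x => absC (u x) ^+ 2)).
  apply: (@integrable_compact_support _ _ _ M) => // [|x /u0 ->]; last by rewrite absC0 expr0n.
  under eq_fun do rewrite absC2 !expr2.
  by move=> x; apply: cvgD; apply: cvgM; try exact: c1; exact: c2.
by under eq_integral => x _ do rewrite /comp gee0_abs ?lee_fin ?sqr_ge0 //.
Qed.

Lemma smooth_compact0 (R : realType) : smooth_compact (fun=> 0 : Cplx R).
Proof.
split; last by exists 0.
by move=> k x; split; apply: diff_times_derivable; exact: diff_times_cst.
Qed.

Lemma Lq2norm2_0 (R : realType) (q : R) : Lq2norm2 q (fun=> 0) = 0%E.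
Proof. by apply: esum1 => n _; rewrite /= absC2_pair0 mulr0. Qed.

(** * From the test vectors to all of H *)

Section Approximation.
Variables (R : realType) (q : R) (T : R -> Cplx R) (Fm Fp : Hsp R -> R -> Cplx R).
Hypotheses (q0 : 0 < q) (q1 : q < 1) (T1 : forall l, absC (T l) = 1).
Hypotheses (Fm_iso : isometric_into_L2 q Fm) (Fp_iso : isometric_into_L2 q Fp).
Hypothesis test_coincide : forall f, test_vector f -> inH q f -> coincide q T Fm Fp f.
Local Notation mu := (@lebesgue_measure R).
Local Notation coincides := (coincide q T Fm Fp).

(** * The two outer components, treated through an abstract embedding [emb] *)

Section HalfLine.
Variables (D : set (measurableTypeR R)) (emb : (R -> Cplx R) -> Hsp R).
Hypothesis mD : measurable D.
Hypothesis emb_lin : forall a u v, emb (a *: u + v) = a *: emb u + emb v.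
Hypothesis emb_inH : forall u, inH q (emb u) <-> L2 D u.
Hypothesis emb_norm : forall u, Hnorm2 q (emb u) = L2norm2 D u.
Hypothesis emb_test : forall u, smooth_compact u -> test_vector (emb u).
Hypothesis emb_eqH : forall u v, (forall x, D x -> u x = v x) -> eqH (emb u) (emb v).

(** The density principle for the property that [emb u] coincides: bumps are test vectors, and a
    dominated limit is a limit in the norm of H, under which coincidence is closed. *)
Lemma coincide_real (u : R -> R) : measurable_fun setT (u : measurableTypeR R -> R) ->
  (\int[mu]_(x in D) (u x ^+ 2)%:E < +oo)%E -> coincides (emb (fun x => toC (u x))).
Proof.
apply: (@density_L2 R D (fun u => coincides (emb (fun x => toC (u x)))) mD).
- move=> a v w cv cw.
  have := coincide_lin q0 q1 Fm_iso Fp_iso (toC a) cv cw; rewrite -emb_lin.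
  congr coincide; congr emb; apply/funext => x.
  by rewrite -[LHS]/(toC a * toC (v x) + toC (w x)) toCD toCM.
- move=> u_ v g cu mv mg g2 ug uv.
  have mu_ n : measurable_fun D (u_ n : measurableTypeR R -> R).
    by have [/emb_inH[[]]] := cu n.
  have mvD : measurable_fun D (v : measurableTypeR R -> R) by exact: measurable_funTS.
  have mgD : measurable_fun D (g : measurableTypeR R -> R) by exact: measurable_funTS.
  have [v2 lim0] := dominated_L2_cvg mD mu_ mvD mgD g2 ug uv.
  apply: (coincide_closed q0 q1 T1 Fm_iso Fp_iso (u := fun n => emb (fun x => toC (u_ n x)))).
  + by apply/emb_inH; exact: L2_toC.
  + exact: cu.
  + have E n : Hnorm2 q (-1 *: emb (fun x => toC (u_ n x)) + emb (fun x => toC (v x))) =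
        (\int[mu]_(x in D) ((v x - u_ n x) ^+ 2)%:E)%E.
      rewrite -emb_lin emb_norm -L2norm2_toC; congr L2norm2; apply/funext => x.
      by rewrite -[LHS]/(-1 * toC (u_ n x) + toC (v x)) mulN1r -toCN -toCD addrC.
    by under eq_fun do rewrite E.
- move=> a b n; apply: test_coincide; first exact/emb_test/smooth_compact_bump.
  by apply/emb_inH/smooth_compact_L2 => //; exact: smooth_compact_bump.
Qed.

(** Real and imaginary parts are extended by 0 off [D] to be measurable on the whole line.
    Reassembled, they agree with [u] on [D], hence as vectors of H. *)
Lemma coincide_L2 (u : R -> Cplx R) : L2 D u -> coincides (emb u).
Proof.
move=> uL; have [[mr mi] u2] := uL.
pose ur := (fun x => ReC (u x)) \_ D; pose ui := (fun x => ImC (u x)) \_ D.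
have mur : measurable_fun setT (ur : measurableTypeR R -> R).
  exact: (iffLR (measurable_restrictT _ mD) mr).
have mui : measurable_fun setT (ui : measurableTypeR R -> R).
  exact: (iffLR (measurable_restrictT _ mD) mi).
have fin (v : R -> R) : measurable_fun setT (v : measurableTypeR R -> R) ->
    (forall x, v x ^+ 2 <= absC (u x) ^+ 2) -> (\int[mu]_(x in D) (v x ^+ 2)%:E < +oo)%E.
  move=> mv vu; apply: le_lt_trans u2; apply: ge0_le_integral => //.
  - by move=> x _; rewrite lee_fin sqr_ge0.
  - by apply/measurable_EFinP; apply: measurable_funX; exact: measurable_funTS.
  - by apply/measurable_EFinP; exact: measurable_absC2.
  - by move=> x _; rewrite lee_fin.
have cr : coincides (emb (fun x => toC (ur x))).
  apply: coincide_real => //; apply: fin => // x; rewrite absC2 /ur patchE.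
  by case: ifP => _; rewrite ?lerDl ?expr0n ?addr_ge0 ?sqr_ge0.
have ci : coincides (emb (fun x => toC (ui x))).
  apply: coincide_real => //; apply: fin => // x; rewrite absC2 /ui patchE.
  by case: ifP => _; rewrite ?lerDr ?expr0n ?addr_ge0 ?sqr_ge0.
have := coincide_lin q0 q1 Fm_iso Fp_iso (imC R) ci cr; rewrite -emb_lin.
apply: (coincide_eqH Fm_iso Fp_iso); first exact/emb_inH.
apply: emb_eqH => x Dx.
rewrite -[LHS]/(imC R * toC (ui x) + toC (ur x)) /ui /ur !patchE mem_set //.
case: (u x) => a b; rewrite /imC /mkC /toC /ReC /ImC /=.
by apply/eqP; rewrite eq_complex /=; apply/andP; split; apply/eqP; ring.
Qed.

End HalfLine.

(** Truncations to finite sets of lattice points are test vectors, and the squared distance to the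
    full vector is the tail of a convergent sum. *)
Lemma coincide_Lq2 (y : int -> Cplx R * Cplx R) : Lq2 q y ->
  coincides ((fun=> 0) : R -> Cplx R, y, (fun=> 0) : R -> Cplx R).
Proof.
move=> y2.
pose w n := (1 - q) * q ^ n * (absC (y n).1 ^+ 2 + absC (y n).2 ^+ 2).
have w0 n : 0 <= w n.
  rewrite mulr_ge0 ?addr_ge0 ?sqr_ge0 // mulr_ge0 ?subr_ge0 ?(ltW q1) //.
  by rewrite exprz_ge0 // ltW.
have tail (e : R) : 0 < e -> exists2 A : set int, finite_set A &
    (\esum_(n in ~` A) (w n)%:E <= e%:E)%E.
  move=> e0; have Sfin : (\esum_(n in [set: int]) (w n)%:E)%E \is a fin_num.
    by rewrite ge0_fin_numE //; apply: esum_ge0 => n _; rewrite lee_fin.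
  (* The sum is a supremum over finite sets, so some finite [A] carries all but [e] of it. *)
  have [_ [A [finA _] <-] Ae] := ub_ereal_sup_adherent e0 Sfin.
  exists A => //; move: Ae Sfin; rewrite -[ereal_sup _]/(\esum_(n in [set: int]) (w n)%:E)%E.
  rewrite (esumID A) //; last by move=> n _; rewrite lee_fin.
  rewrite !setTI -esum_fset //; last by move=> n _; rewrite lee_fin.
  move: (\esum_(n in A) (w n)%:E)%E (\esum_(n in ~` A) (w n)%:E)%E => [a| |] [b| |] //=.
  by rewrite -!EFinD lte_fin lee_fin => ? _; lra.
have y2' (A : set int) : Lq2norm2 q (fun n => if n \in A then 0 else y n) =
    (\esum_(n in ~` A) (w n)%:E)%E.
  rewrite -[~` A]setTI esum_mkcondr; apply: eq_esum => n _; rewrite in_setC.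
  by case: (n \in A) => //=; rewrite absC2_pair0 mulr0.
have zero_L2 (D : set (measurableTypeR R)) : measurable D -> L2 D (fun=> 0).
  by move=> mD; exact: (smooth_compact_L2 mD (smooth_compact0 R)).
have [A_ A_fin A_tail] : exists2 A_ : nat -> set int, forall n, finite_set (A_ n) &
    forall n, (\esum_(k in ~` A_ n) (w k)%:E <= (n.+1%:R^-1)%:E)%E.
  have h n : exists A : set int, finite_set A /\ (\esum_(k in ~` A) (w k)%:E <= (n.+1%:R^-1)%:E)%E.
    by have [|A] := tail n.+1%:R^-1; [rewrite invr_gt0 | exists A].
  by have [A_ hA] := choice h; exists A_ => n; have [] := hA n.
pose v n : Hsp R := ((fun=> 0), (fun k => if k \in A_ n then y k else 0), (fun=> 0)).
have vH n : inH q (v n).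
  split; [exact: (zero_L2 _ (@measurable_Rminus R)) | | exact: (zero_L2 _ (@measurable_Rplus R))].
  apply: le_lt_trans y2; apply: le_esum => k _ /=; rewrite lee_fin.
  by case: (k \in A_ n) => //=; rewrite absC2_pair0 mulr0; exact: w0.
apply: (coincide_closed q0 q1 T1 Fm_iso Fp_iso (u := v)).
- by split => //; [exact: (zero_L2 _ (@measurable_Rminus R))
                   | exact: (zero_L2 _ (@measurable_Rplus R))].
- move=> n; apply: test_coincide => //; split; try exact: smooth_compact0.
  apply: sub_finite_set (A_fin n) => k /=.
  by case: ifPn => [|_ /(_ erefl)//]; rewrite inE.
- have E n : Hnorm2 q (-1 *: v n + ((fun=> 0) : R -> Cplx R, y, (fun=> 0) : R -> Cplx R)) =
      (\esum_(k in ~` A_ n) (w k)%:E)%E.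
    rewrite /Hnorm2 -y2' /=.
    have -> : (-1 *: (fun=> 0 : Cplx R) + (fun=> 0)) = (fun=> 0) :> (R -> Cplx R).
      by apply/funext => x; rewrite -[LHS]/(-1 * 0 + 0) mulr0 addr0.
    rewrite !L2norm2_0 add0e adde0; congr Lq2norm2; apply/funext => k.
    rewrite -[LHS]/(-1 *: (if k \in A_ n then y k else 0) + y k).
    by case: ifP => _; rewrite scaleN1r ?addNr // oppr0 add0r.
  under eq_fun do rewrite E.
  apply: (@squeeze_cvge _ _ _ _ (cst 0%E) _ (fun n => (n.+1%:R^-1)%:E)).
  + by apply: nearW => n; rewrite A_tail andbT; apply: esum_ge0 => k _; rewrite lee_fin.
  + exact: cvg_cst.
  + by apply: cvg_EFin; [apply: nearW | exact: cvg_harmonic].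
Qed.

(** A vector is the sum of its three components, each covered above. *)
Lemma coincide_all f : inH q f -> coincides f.
Proof.
case: f => [[fm y] fp] [/= fmL yL fpL].
have zD (D : set (measurableTypeR R)) : measurable D -> L2 D (fun=> 0).
  by move=> mD; exact: (smooth_compact_L2 mD (smooth_compact0 R)).
have yq0 : Lq2 q (fun=> 0) by rewrite /Lq2 Lq2norm2_0.
have cm : coincides (fm, (fun=> 0), (fun=> 0)).
  apply: (@coincide_L2 (@Rminus R) (fun u => (u, (fun=> 0), (fun=> 0)))) => //.
  - exact: (@measurable_Rminus R).
  - move=> a u v; congr (_, _, _); apply/funext => x.
      by rewrite -[RHS]/(a *: (0 : Cplx R * Cplx R) + 0) scaler0 addr0.
    by rewrite -[RHS]/(a * 0 + 0) mulr0 addr0.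
  - move=> u; split => [[]//|uL]; split => //; exact: (zD _ (@measurable_Rplus R)).
  - by move=> u; rewrite /Hnorm2 /= Lq2norm2_0 L2norm2_0 !adde0.
  - by move=> u us; split => //; [rewrite (_ : [set n | _] = set0) // -subset0 => n /=
                          | exact: smooth_compact0].
  - by move=> u v uv; split => //; apply: aeW.
have cp : coincides ((fun=> 0), (fun=> 0), fp).
  apply: (@coincide_L2 (@Rplus R) (fun u => ((fun=> 0), (fun=> 0), u))) => //.
  - exact: (@measurable_Rplus R).
  - move=> a u v; congr (_, _, _); apply/funext => x.
      by rewrite -[RHS]/(a * 0 + 0) mulr0 addr0.
    by rewrite -[RHS]/(a *: (0 : Cplx R * Cplx R) + 0) scaler0 addr0.
  - move=> u; split => [[]//|uL]; split => //; exact: (zD _ (@measurable_Rminus R)).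
  - by move=> u; rewrite /Hnorm2 /= Lq2norm2_0 L2norm2_0 !add0e.
  - by move=> u us; split => //; [exact: smooth_compact0
                          | rewrite (_ : [set n | _] = set0) // -subset0 => n /=].
  - by move=> u v uv; split => //; apply: aeW.
have := coincide_lin q0 q1 Fm_iso Fp_iso 1 cm
  (coincide_lin q0 q1 Fm_iso Fp_iso 1 (coincide_Lq2 yL) cp).
congr coincide; congr (_, _, _); apply/funext => x.
- by rewrite -[LHS]/(1 * fm x + (1 * 0 + 0)) mul1r mulr0 !addr0.
- by rewrite -[LHS]/(1 *: (0 : Cplx R * Cplx R) + (1 *: y x + 0)) scaler0 add0r scale1r addr0.
- by rewrite -[LHS]/(1 * 0 + (1 * 0 + fp x)) !mulr0 !add0r.
Qed.

End Approximation.

(** * Identification of the scattering function *)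

Unset Implicit Arguments.
Set Strict Implicit.

Theorem theorem8 (R : realType) (q : R) (p r : int -> R) (h : Cplx R) (delta : R)
    (phi psi : Cplx R -> int -> Cplx R * Cplx R) (m : Cplx R -> Cplx R)
    (U : R -> Hsp R -> Hsp R) (Fm Fp : Hsp R -> R -> Cplx R)
    (hq0 : 0 < q) (hq1 : q < 1)
    (hp : qregular p) (hr : qregular r)
    (hp0 : forall n, p n != 0) (hr0 : forall n, r n != 0)
    (hh : 0 < ImC h) (hd : 0 < delta) (hdh : delta ^+ 2 = 2 * ImC h)
    (hphi : forall l, is_solution q p r l 0 1 (phi l))
    (hpsi : forall l, is_solution q p r l 1 0 (psi l))
    (hm : titchmarsh_weyl q phi psi m)
    (hmero : meromorphic m)
    (hU : exp_group q (Mh q p r h delta) U)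
    (hFm : spectral_representation q U (@incoming_space R) (@hardy2 R (-1))
             (U_minus h delta phi psi m) Fm)
    (hFp : spectral_representation q U (@outgoing_space R) (@hardy2 R 1)
             (U_plus h delta phi psi m) Fp) :
  scattering_matrix q Fm Fp (fun l => (S_fun h m l)^*).
Proof.
have mconj := titchmarsh_weyl_conj hq0 hq1 hp hr hphi hpsi hm.
have SS := S_fun_unimodular hh mconj hmero.
have T1 l : absC (S_fun h m l)^* = 1.
  (* The modulus of [S_fun] squares to 1, and being nonnegative it is not -1. *)
  have := congr1 (@absC R) (SS l); rewrite absCM absCJ (absC_toC 1) normr1 -expr2 => /eqP.
  by rewrite sqrf_eq1 => /orP[/eqP //|/eqP e]; have := absC_ge0 (S_fun h m l); rewrite e ler0N1.
have isom K D E F (hF : spectral_representation q U D K E F) : isometric_into_L2 q F.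
  by case: hF => *; split.
have test f : test_vector f -> inH q f -> coincide q (fun l => (S_fun h m l)^*) Fm Fp f.
  move=> tf fH; split => //; have [s1 fin s3] := tf.
  apply: ae_imply2 (sr_formula hFm tf) (sr_formula hFp tf) => l /(_ I) -> /(_ I) -> _.
  rewrite mulrCA; congr (_ * _); rewrite /Hip !mulrDr; congr (_ + _ + _).
  - exact: (L2ipZ (S_fun h m l) l (@measurable_Rminus R) s1).
  - rewrite /Lq2ip -finite_support_jacksonZ.
      congr jackson; apply/funext => n.
      rewrite -[(U_plus _ _ _ _ _ _).1.2]/(weyl_part delta phi psi m h^* l).
      rewrite -[(U_minus _ _ _ _ _ _).1.2]/(weyl_part delta phi psi m h l).
      rewrite (weyl_part_S_fun hh mconj hmero) -[(_ *: _).1]/(_ * _) -[(_ *: _).2]/(_ * _).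
      by rewrite !rmorphM mulrDr !(mulrCA _ (S_fun h m l)^*).
    (* The products being summed vanish wherever the test vector does. *)
    apply: sub_finite_set fin => n /= + fn; apply.
    by rewrite fn !mul0r addr0.
  (* In the third component [U_minus] has the factor [S_h^*]; conjugated by the pairing it becomes
     [S_h], which cancels against the outer [S_h^*]. *)
  - have e1 := L2ipZ ((S_fun h m l)^*) l (@measurable_Rplus R) s3.
    by rewrite [in RHS]/U_minus /= e1 conjCK mulrA [_^* * _]mulrC SS mul1r.
move=> f fH; have im := isom _ _ _ _ hFm; have ip := isom _ _ _ _ hFp.
exact: (coincide_all hq0 hq1 T1 im ip test fH).2.
Qed.
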